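(* Let $k$ be a field complete with respect to a non-trivial non-archimedean absolute value, and let $f:\mathbb{A}^{1,an}_k\to\mathbb{A}^{1,an}_k$ be any transcendental entire map. Then the basin of attraction of infinity $\{x\in\mathbb{A}^{1,an}_k:\ f^n(x)\to\infty\}$ is connected. Moreover, for any $x\in\mathbb{A}^{1,an}_k$, there exists $y\in(x,\infty)\cap J(f)$ such that $\{f^n(y)\}_{n\in\mathbb{N}}$ is an increasing sequence converging to $\infty$. In particular, the Julia set $J(f)$ always contains non-rigid points, and Fatou components (connected components of the Fatou set) are bounded.
   Context: $\mathbb{A}^{1,an}_k$ is the set of multiplicative semi-norms on $k[T]$ restricting to the absolute value of $k$, with the topology of pointwise convergence; $|P(x)|$ denotes the value of the semi-norm $x$ at $P$. $\mathbb{P}^{1,an}_k=\mathbb{A}^{1,an}_k\cup\{\infty\}$ is its one-point compactification. The partial order is $x\le x'$ iff $|P(x)|\le|P(x')|$ for all $P\in k[T]$; $(x,\infty)=\{y\in\mathbb{A}^{1,an}_k:\ y>x\}$. ''Increasing'' refers to this order. A subset of $\mathbb{A}^{1,an}_k$ is bounded if $|T|$ is bounded on it. Rigid points: if $k$ is algebraically closed, the points of $k\subset\mathbb{A}^{1,an}_k$; in general, the images of points of $K$ under $\mathbb{A}^{1,an}_K\to\mathbb{A}^{1,an}_k$, with $K$ the completion of an algebraic closure of $k$. A transcendental entire map is an analytic map $\mathbb{A}^{1,an}_k\to\mathbb{A}^{1,an}_k$ (given by an everywhere convergent power series over $k$) which is not a polynomial. A family $\mathcal{F}$ of analytic maps from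 an open set $U$ to $\mathbb{P}^{1,an}_k$ is normal if for any sequence $f_n\in\mathcal{F}$ and any $y\in U$ there exist a neighborhood $V\ni y$ and a subsequence $f_{n_j}$ converging pointwise on $V$ to a continuous function $V\to\mathbb{P}^{1,an}_k$. The Fatou set $F(f)$ is the set of points $x\in\mathbb{A}^{1,an}_k$ such that the sequence of iterates $\{f^n\}$ forms a normal family in a neighborhood of $x$; the Julia set $J(f)$ is the complement of $F(f)$ in $\mathbb{A}^{1,an}_k$. *)

(* Defs.v *)
From HB Require Import structures.
From mathcomp Require Import all_boot all_order all_algebra.
From mathcomp Require Import all_classical all_reals all_analysis.

Set Implicit Arguments.
Unset Strict Implicit.
Unset Printing Implicit Defensive.

Import Order.TTheory GRing.Theory Num.Theory.
Import numFieldNormedType.Exports.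

Local Open Scope classical_set_scope.
Local Open Scope ring_scope.

Record nonarch_absval (R : realType) (k : fieldType) := NonarchAbsval {
  absv :> k -> R;
  absv_ge0 : forall a, 0 <= absv a;
  absv_eq0 : forall a, absv a = 0 <-> a = 0;
  absvM : forall a b, absv (a * b) = absv a * absv b;
  absvD : forall a b, absv (a + b) <= Num.max (absv a) (absv b) }.

Definition absv_nontrivial (R : realType) (k : fieldType)
    (v : nonarch_absval R k) : Prop :=
  exists a : k, a != 0 /\ v a != 1.

Definition absv_complete (R : realType) (k : fieldType)
    (v : nonarch_absval R k) : Prop :=
  forall u : nat -> k,
    (forall e : R, 0 < e -> exists N : nat, forall m n : nat,
       (N <= m)%N -> (N <= n)%N -> v (u m - u n) < e) ->
    exists l : k, (fun n => v (u n - l)) @ \oo --> (0 : R).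

(* [a] is the map k -> K; [L] is an algebraic closure of k, whose absolute
   value (the unique one extending v) is the one induced by K. *)
Definition completed_algebraic_closure (R : realType) (k K : fieldType)
    (v : nonarch_absval R k) (w : nonarch_absval R K)
    (a : {rmorphism k -> K}) : Prop :=
  absv_complete w /\
  exists (L : fieldType) (i : {rmorphism k -> L}) (j : {rmorphism L -> K}),
    [/\ GRing.closed_field_axiom L,
        forall z : L, algebraicOver i z,
        forall c : k, a c = j (i c),
        forall c : k, w (a c) = v c &
        forall (z : K) (e : R), 0 < e -> exists y : L, w (z - j y) < e].

(* The Berkovich affine line. Together with multiplicativity, [snC] makes the
   triangle inequality equivalent to the ultrametric one. *)
Record A1an (R : realType) (k : fieldType) (v : nonarch_absval R k) := A1An {
  sn :> {poly k} -> R;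
  sn_ge0 : forall P, 0 <= sn P;
  snC : forall c : k, sn c%:P = v c;
  snM : forall P Q, sn (P * Q) = sn P * sn Q;
  snD : forall P Q, sn (P + Q) <= sn P + sn Q }.

HB.instance Definition _ (R : realType) (k : fieldType)
    (v : nonarch_absval R k) := gen_eqMixin (A1an v).
HB.instance Definition _ (R : realType) (k : fieldType)
    (v : nonarch_absval R k) := gen_choiceMixin (A1an v).
HB.instance Definition _ (R : realType) (k : fieldType)
    (v : nonarch_absval R k) :=
  Topological.copy (A1an v)
    (initial_topology (fun x : A1an v => (sn x : {ptws {poly k} -> R}))).

(* [None] is the point at infinity. *)
Definition P1an (R : realType) (k : fieldType) (v : nonarch_absval R k) :=
  one_point_compactification (A1an v).
HB.instance Definition _ (R : realType) (k : fieldType)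
    (v : nonarch_absval R k) := Topological.on (P1an v).

Section BerkovichLine.
Context (R : realType) (k : fieldType) (v : nonarch_absval R k).
Implicit Types (x y : A1an v) (f : A1an v -> A1an v).

Definition ble x y : Prop := forall P : {poly k}, x P <= y P.

Definition blt x y : Prop := ble x y /\ x <> y.

Definition above x : set (A1an v) := [set y | blt x y].

Definition bounded_an (A : set (A1an v)) : Prop :=
  exists M : R, forall x, A x -> x 'X <= M.

(* x is the image in A1an of the point of A^1_K given by some b in K, i.e. of
   the seminorm Q |-> |Q(b)| on K[T]. K is unique up to isometry over k, so
   the choice made by the existential quantifier is immaterial. *)
Definition rigid x : Prop :=
  exists (K : fieldType) (w : nonarch_absval R K) (a : {rmorphism k -> K}),
    completed_algebraic_closure v w a /\
    exists b : K, forall P : {poly k}, x P = w (map_poly a P).[b].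

(* The power series \sum_i c i T^i. *)
Definition everywhere_convergent (c : nat -> k) : Prop :=
  forall r : R, 0 <= r -> (fun n => v (c n) * r ^+ n) @ \oo --> (0 : R).

(* f is the analytic map with power series c: |P(f(x))| = |(P o f)(x)|, where
   the seminorm x is extended to entire series by continuity, so that
   |(P o f)(x)| is the limit of its values at P o (n-th truncation of f). *)
Definition given_by_series f (c : nat -> k) : Prop :=
  forall x (P : {poly k}),
    (fun n => x (P \Po \poly_(i < n) c i)) @ \oo --> f x P.

Definition transcendental_entire f : Prop :=
  exists c : nat -> k,
    [/\ everywhere_convergent c,
        given_by_series f c &
        forall N : nat, exists2 n : nat, (N <= n)%N & c n != 0].

Definition tends_to_infty (u : nat -> A1an v) : Prop :=
  (fun n => Some (u n) : P1an v) @ \oo --> (None : P1an v).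

Definition basin_infty f : set (A1an v) :=
  [set x | tends_to_infty (fun n => iter n f x)].

(* Maps on U are represented by total functions; only their values on U
   matter. *)
Definition normal_on (U : set (A1an v)) (F : set (A1an v -> P1an v)) : Prop :=
  forall u : nat -> A1an v -> P1an v, (forall n, F (u n)) ->
  forall y, U y ->
  exists (V : set (A1an v)) (phi : nat -> nat) (g : A1an v -> P1an v),
    [/\ nbhs y V, V `<=` U,
        {homo phi : m n / (m < n)%N},
        forall z, V z -> (fun j => u (phi j) z) @ \oo --> g z &
        {within V, continuous g}].

Definition iterates f : set (A1an v -> P1an v) :=
  range (fun (n : nat) (x : A1an v) => Some (iter n f x) : P1an v).

Definition Fatou f : set (A1an v) :=
  [set x | exists U : set (A1an v), [/\ open U, U x & normal_on U (iterates f)]].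

Definition Julia f : set (A1an v) := ~` Fatou f.

Definition Fatou_component f (C : set (A1an v)) : Prop :=
  exists2 x, Fatou f x & C = connected_component (Fatou f) x.

End BerkovichLine.

(* Main.v *)
Require Import Defs.
From mathcomp Require Import all_boot all_order all_algebra.
From mathcomp Require Import all_classical all_reals all_analysis.
From mathcomp Require Import ring lra zify.

Set Implicit Arguments.
Unset Strict Implicit.
Unset Printing Implicit Defensive.

Import Order.TTheory GRing.Theory Num.Theory.
Import numFieldNormedType.Exports.

Local Open Scope classical_set_scope.
Local Open Scope ring_scope.

(** Discs centered at the origin. Write [eta r] for the Gauss point of radius
    [r] and [mu r] for the maximum of the [|c_i| r ^ i], where [f] is the series
    with coefficients [c_i]. As [f] is transcendental, [mu r >= 2 r] for large
    [r], and then [f] maps [eta r] to [eta (mu r)]. Hence the orbits of these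
    Gauss points increase to infinity. They lie above any given point, so
    everything except the connectedness of the basin follows from the existence
    of Julia points [eta r] of arbitrarily large radius: Gauss points are not
    rigid ([eta_not_rigid]), and [eta r] separates its disc from the rest of the
    line ([eta_separates]), so a connected part of the Fatou set that meets the
    disc stays in it. The basin is connected because [f] is monotone: with [x]
    the basin contains the segment from [x] to infinity ([thicken]), and two
    such segments share Gauss points.

    Preimages. Points are produced without extending [k]. A minimal element
    among the submultiplicative seminorms below a given one is multiplicative
    ([exists_mult_seminorm], the nonemptiness of the Berkovich spectrum). When
    applied to a quotient seminorm, this gives a power series a zero on each
    circle where it has two dominant terms ([exists_zero]); the coefficients may
    lie in any commutative ring with a multiplicative seminorm. Over the ring
    [k[S]] normed by a point [y], the zeros of [f(T) - S] are the preimages of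
    [y] ([exists_preimage]), and over [k] the zeros of [f(T) - T] are fixed
    points ([exists_fixed_point]).

    Julia points. Let [p] be a fixed point. A radius is critical if [f] has two
    dominant terms there; by transcendence critical radii are unbounded, and
    they pull back under the iterates of [mu] into any interval [[r, mu r]]. If
    the [n]-th iterate of [mu] maps [r] to a critical radius, then some point
    [z] with [|T(z)| = r] follows the orbit of [eta r] in absolute value for [n]
    steps, and then falls on [p] ([exists_falling_orbit]). A Gauss point [eta r]
    that is a limit of points falling on [p] lies in the Julia set, as its own
    orbit escapes ([julia_of_falling]). There are two cases. If the orbit of
    some [r] meets critical radii infinitely often, points that fall on [p] at
    different times lie in different directions from [eta r]; as only finitely
    many directions are detected by a polynomial
    ([sep_eventually]), these points converge to [eta r]. Otherwise the
    pulled-back critical radii in [[r, mu r]] accumulate at a radius different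
    from almost all of them, and the corresponding points converge to its Gauss
    point ([cvg_eta_punctured]). *)

(** * Infima of sets of nonnegative reals *)

Section NonnegativeInfima.
Context (R : realType).
Implicit Types (A : set R) (x y z t : R).

Lemma nneg_inf_le A x : (forall t, A t -> 0 <= t) -> A x -> inf A <= x.
Proof. by move=> A0 Ax; apply: ge_inf => //; exists 0 => t /A0. Qed.

Lemma nneg_inf_ge0 A : (forall t, A t -> 0 <= t) -> 0 <= inf A.
Proof.
move=> A0; have [[a Aa]|/set0P/negP/negPn/eqP->] := pselect (A !=set0).
  by apply: lb_le_inf; [exists a | move=> t /A0].
by rewrite inf0.
Qed.

Lemma nneg_inf_lt A x : A !=set0 -> inf A < x -> exists2 t, A t & t < x.
Proof. by move=> A0 /inf_lt; apply. Qed.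

Lemma le_mul_approx x y z : 0 <= x -> 0 <= y ->
  (forall s t, x < s -> y < t -> z <= s * t) -> z <= x * y.
Proof.
move=> x0 y0 H; apply/ler_addgt0Pr => e e0.
pose d := Num.min 1 (e / (x + y + 1)).
have p0 : 0 < x + y + 1 by lra.
have d0 : 0 < d by rewrite lt_min ltr01 divr_gt0.
have d1 : d <= 1 by rewrite ge_min lexx.
have de : d * (x + y + 1) <= e by rewrite -ler_pdivlMr // ge_min lexx orbT.
apply: (le_trans (H (x + d) (y + d) _ _)); [lra | lra |].
have : d * (x + y + d) <= d * (x + y + 1) by rewrite ler_pM2l //; lra.
lra.
Qed.

Lemma le_max_approx x y z : (forall t, x < t -> y < t -> z <= t) ->
  z <= Num.max x y.
Proof.
move=> H; apply/ler_addgt0Pr => e e0; apply: H.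
- by rewrite -[ltLHS]addr0 ler_ltD // le_max lexx.
- by rewrite -[ltLHS]addr0 ler_ltD // le_max lexx orbT.
Qed.

End NonnegativeInfima.

(** * Multiplicative seminorms below a submultiplicative one *)

(** A multiplicative ultrametric seminorm on a commutative ring. *)
Record mult_seminorm (R : realType) (A : comNzRingType) (q : A -> R) : Prop :=
  MultSeminorm {
    ms_ge0 : forall a, 0 <= q a;
    ms_0 : q 0 = 0;
    ms_1 : q 1 = 1;
    ms_M : forall a b, q (a * b) = q a * q b;
    ms_D : forall a b, q (a + b) <= Num.max (q a) (q b) }.

(** A submultiplicative ultrametric seminorm [q] on [B] for which the elements
    of [S] are multiplicative, with prescribed values [Y]. *)
Record submult_seminorm (R : realType) (B : comNzRingType) (S : set B)
    (Y : B -> R) (q : B -> R) : Prop := SubmultSeminorm {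
    sm_ge0 : forall b, 0 <= q b;
    sm_0 : q 0 = 0;
    sm_1 : q 1 = 1;
    sm_M : forall a b, q (a * b) <= q a * q b;
    sm_B : forall a b, q (a - b) <= Num.max (q a) (q b);
    sm_S : forall s b, S s -> q (s * b) = Y s * q b }.

Section Spectrum.
Context (R : realType) (B : comNzRingType) (S : set B) (Y : B -> R).
Hypothesis Y0 : forall b, 0 <= Y b.
Implicit Types (q : B -> R) (a b : B).
Local Notation sms := (submult_seminorm S Y).

Lemma sm_N q b : sms q -> q (- b) = q b.
Proof.
move=> Q; have N c : q (- c) <= q c.
  rewrite -sub0r; apply: le_trans (sm_B Q _ _) _.
  by rewrite (sm_0 Q) ge_max lexx (sm_ge0 Q).
by apply/eqP; rewrite eq_le N /= -{1}(opprK b) N.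
Qed.

Lemma sm_D q a b : sms q -> q (a + b) <= Num.max (q a) (q b).
Proof. by move=> Q; rewrite -(sm_N b Q) -{1}(opprK b) (sm_B Q). Qed.

Lemma sm_sum q (I : Type) (r : seq I) (P : pred I) (F : I -> B) (M : R) :
  sms q -> 0 <= M -> (forall i, P i -> q (F i) <= M) ->
  q (\sum_(i <- r | P i) F i) <= M.
Proof.
move=> Q M0 FM; elim/big_ind : _ => //; first by rewrite (sm_0 Q).
by move=> x y xM yM; apply: le_trans (sm_D _ _ Q) _; rewrite ge_max xM.
Qed.

Lemma sm_Mn q b n : sms q -> q (b *+ n) <= q b.
Proof.
move=> Q; elim: n => [|n IH]; first by rewrite mulr0n (sm_0 Q) (sm_ge0 Q).
by rewrite mulrS; apply: le_trans (sm_D _ _ Q) _; rewrite ge_max lexx IH.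
Qed.

Lemma sm_X q b n : sms q -> q (b ^+ n) <= q b ^+ n.
Proof.
move=> Q; elim: n => [|n IH]; first by rewrite !expr0 (sm_1 Q).
rewrite !exprS; apply: le_trans (sm_M Q _ _) _.
by rewrite ler_wpM2l // (sm_ge0 Q).
Qed.

(** The exponential rates [t] that dominate the growth of the powers of [b]. *)
Definition growth q b : set R :=
  [set t | 0 < t /\ exists C, forall n, q (b ^+ n) <= C * t ^+ n].

(** The spectral seminorm of [q], defined as an infimum of growth rates, so
    that neither roots nor limits occur. *)
Definition spectral q b : R := inf (growth q b).

Lemma growth_ge0 q b t : growth q b t -> 0 <= t.
Proof. by move=> -[/ltW]. Qed.

Lemma growth_self q b t : sms q -> 0 < t -> q b <= t -> growth q b t.
Proof.
move=> Q t0 bt; split => //; exists 1 => n; rewrite mul1r.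
apply: le_trans (sm_X _ _ Q) _; rewrite lerXn2r ?nnegrE ?(sm_ge0 Q) //.
exact: ltW.
Qed.

Lemma growth_nonempty q b : sms q -> growth q b !=set0.
Proof.
move=> Q; exists (q b + 1); apply: growth_self => //.
  by rewrite ltr_wpDl // (sm_ge0 Q).
by rewrite lerDl.
Qed.

Lemma growthW q b s t : sms q -> growth q b s -> s <= t -> growth q b t.
Proof.
move=> Q [s0 [C HC]] st; split; first exact: lt_le_trans st.
exists C => n; apply: le_trans (HC n) _; rewrite ler_wpM2l //.
  by have := HC 0%N; rewrite !expr0 (sm_1 Q) mulr1; apply: le_trans.
by rewrite lerXn2r // nnegrE ltW // (lt_le_trans s0).
Qed.

Lemma spectral_growth q b t : sms q -> spectral q b < t -> growth q b t.
Proof.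
move=> Q /(nneg_inf_lt (growth_nonempty b Q))[s gs st].
by apply: growthW gs _ => //; exact: ltW.
Qed.

Lemma spectral_le q b t : growth q b t -> spectral q b <= t.
Proof. by apply: nneg_inf_le => s /growth_ge0. Qed.

Lemma spectral_ge0 q b : 0 <= spectral q b.
Proof. by apply: nneg_inf_ge0 => s /growth_ge0. Qed.

Lemma spectral_le_self q b : sms q -> spectral q b <= q b.
Proof.
move=> Q; apply/ler_addgt0Pr => e e0; apply/spectral_le/growth_self => //.
  by rewrite ltr_wpDl // (sm_ge0 Q).
by rewrite lerDl ltW.
Qed.

Lemma growth_add q a b t : sms q -> growth q a t -> growth q b t ->
  growth q (a - b) t.
Proof.
move=> Q [t0 [C HC]] [_ [D HD]]; split => //.
have C0 : 0 <= C.
  by have := HC 0%N; rewrite !expr0 mulr1; apply: le_trans (sm_ge0 Q _).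
have D0 : 0 <= D.
  by have := HD 0%N; rewrite !expr0 mulr1; apply: le_trans (sm_ge0 Q _).
exists (C * D) => n; rewrite exprDn; apply: sm_sum => //.
  by rewrite !mulr_ge0 // exprn_ge0 // ltW.
move=> i _; apply: le_trans (sm_Mn _ _ Q) _.
apply: le_trans (sm_M Q _ _) _.
have -> : q ((- b) ^+ i) = q (b ^+ i).
  by rewrite exprNn -signr_odd; case: odd; rewrite ?expr1 ?expr0 ?mulN1r ?mul1r
    ?(sm_N _ Q).
have -> : C * D * t ^+ n = (C * t ^+ (n - i)) * (D * t ^+ i).
  by rewrite mulrACA -exprD subnK // -ltnS.
by apply: ler_pM; rewrite ?(sm_ge0 Q).
Qed.

Lemma spectral_submult q : sms q -> sms (spectral q).
Proof.
move=> Q; split.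
- exact: spectral_ge0.
- apply/eqP; rewrite eq_le spectral_ge0 andbT -(sm_0 Q).
  exact: spectral_le_self.
- apply/eqP; rewrite eq_le -{1}(sm_1 Q) spectral_le_self //=.
  apply: lb_le_inf; first exact: growth_nonempty.
  move=> t [t0 [C HC]]; rewrite leNgt; apply/negP => t1.
  have C0 : 0 < C.
    by have := HC 0%N; rewrite !expr0 mulr1 (sm_1 Q); apply: lt_le_trans.
  have /cvgrPdist_lt /(_ C^-1) : (fun n => t ^+ n) @ \oo --> (0 : R).
    by apply: cvg_expr; rewrite gtr0_norm.
  rewrite invr_gt0 => /(_ C0)[N _ /(_ N (leqnn N))] /=.
  rewrite sub0r normrN gtr0_norm ?exprn_gt0 //.
  move=> H.
  have := HC N; rewrite expr1n (sm_1 Q) leNgt.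
  by rewrite -ltr_pdivlMl // mulr1 H.
- move=> a b; apply: le_mul_approx; rewrite ?spectral_ge0 // => s t.
  move=> /spectral_growth - /(_ Q)[s0 [C HC]].
  move=> /spectral_growth - /(_ Q)[t0 [D HD]].
  apply: spectral_le; split; first exact: mulr_gt0.
  exists (C * D) => n; rewrite !exprMn mulrACA.
  by apply: le_trans (sm_M Q _ _) _; apply: ler_pM; rewrite ?(sm_ge0 Q).
- move=> a b; apply: le_max_approx => t ta tb; apply: spectral_le.
  by apply: growth_add => //; exact: spectral_growth.
- move=> s b Ss; have qX n : q ((s * b) ^+ n) = Y s ^+ n * q (b ^+ n).
    rewrite exprMn; elim: n (b ^+ n) => [|n IH] c.
      by rewrite !expr0 !mul1r.
    by rewrite !exprS -!mulrA (sm_S Q) // IH.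
  apply/eqP; rewrite eq_le; apply/andP; split.
    apply: le_mul_approx; rewrite ?spectral_ge0 // => u t su.
    move=> /spectral_growth - /(_ Q)[t0 [D HD]].
    apply: spectral_le; split; first by rewrite mulr_gt0 // (le_lt_trans _ su).
    exists D => n; rewrite qX exprMn mulrCA.
    apply: ler_pM; rewrite ?(sm_ge0 Q) ?exprn_ge0 ?Y0 //.
    apply: lerXn2r; rewrite ?nnegrE ?Y0 //; apply: ltW => //.
    exact: le_lt_trans su.
  have [->|sN0] := eqVneq (Y s) 0; first by rewrite mul0r spectral_ge0.
  have s0 : 0 < Y s by rewrite lt0r sN0 Y0.
  rewrite -ler_pdivlMl //; apply/ler_addgt0Pr => e e0.
  have : spectral q (s * b) < spectral q (s * b) + Y s * e.
    by rewrite ltrDl mulr_gt0.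
  move=> /spectral_growth - /(_ Q)[t0 [D HD]].
  have -> : (Y s)^-1 * spectral q (s * b) + e =
            (spectral q (s * b) + Y s * e) / Y s by field.
  apply: spectral_le; split; first by rewrite divr_gt0.
  exists D => n; rewrite exprMn mulrA exprVn ler_pdivlMr ?exprn_gt0 //.
  by rewrite mulrC -qX.
Qed.

(** When [q] is multiplicative on the powers of [a], this is the largest seminorm
    below [q] that has the same value at [a] and for which [a] is
    multiplicative. *)
Definition shift q a b : R := inf (range (fun n => q (a ^+ n * b) / q a ^+ n)).

Lemma shift_submult q a : sms q -> 0 < q a ->
  (forall n, q (a ^+ n) = q a ^+ n) -> sms (shift q a).
Proof.
move=> Q a0 aX.
have v0 b n : 0 <= q (a ^+ n * b) / q a ^+ n.
  by rewrite divr_ge0 ?exprn_ge0 ?(sm_ge0 Q).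
have r0 b t : range (fun n => q (a ^+ n * b) / q a ^+ n) t -> 0 <= t.
  by move=> [n _ <-]; exact: v0.
have vD b n m : q (a ^+ (n + m) * b) / q a ^+ (n + m) <=
                q (a ^+ n * b) / q a ^+ n.
  rewrite addnC exprD -mulrA exprD ler_pdivrMr ?mulr_gt0 ?exprn_gt0 //.
  rewrite [leRHS]mulrCA divfK ?gt_eqF ?exprn_gt0 //.
  by rewrite -aX; apply: sm_M Q _ _.
have le_sh b n : shift q a b <= q (a ^+ n * b) / q a ^+ n.
  by apply: nneg_inf_le; [exact: r0 | exists n].
have sh0 b : 0 <= shift q a b by apply: nneg_inf_ge0 => t /r0.
have sh_lt b t : shift q a b < t ->
    exists n, forall m, (n <= m)%N -> q (a ^+ m * b) / q a ^+ m < t.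
  move=> /nneg_inf_lt[|_ [n _ <-] nt].
    by exists (q (a ^+ 0 * b) / q a ^+ 0); exists 0%N.
  by exists n => m /subnKC <-; apply: le_lt_trans (vD _ _ _) nt.
have le_shP b t : (forall n, t <= q (a ^+ n * b) / q a ^+ n) ->
    t <= shift q a b.
  move=> H; apply: lb_le_inf.
    by exists (q (a ^+ 0 * b) / q a ^+ 0); exists 0%N.
  by move=> _ [n _ <-].
split=> //.
- apply/eqP; rewrite eq_le sh0 andbT; apply: le_trans (le_sh _ 0%N) _.
  by rewrite mulr0 (sm_0 Q) mul0r.
- apply/eqP; rewrite eq_le; apply/andP; split.
    by apply: le_trans (le_sh _ 0%N) _; rewrite !expr0 mulr1 (sm_1 Q) divr1.
  by apply: le_shP => n; rewrite mulr1 aX divff // gt_eqF // exprn_gt0.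
- move=> b c; apply: le_mul_approx => // s t.
  move=> /sh_lt[n Hn] /sh_lt[m Hm]; pose N := maxn n m.
  apply: le_trans (le_sh _ (N + N)%N) _.
  have -> : a ^+ (N + N) * (b * c) = (a ^+ N * b) * (a ^+ N * c).
    by rewrite exprD mulrACA.
  rewrite exprD invfM; apply: (@le_trans _ _
    ((q (a ^+ N * b) / q a ^+ N) * (q (a ^+ N * c) / q a ^+ N))).
    rewrite [leRHS]mulrACA ler_wpM2r ?(sm_M Q) //.
    by rewrite mulr_ge0 // invr_ge0 exprn_ge0 // ltW.
  by apply: ler_pM => //; apply: ltW; [apply: Hn; rewrite leq_maxl
                                      |apply: Hm; rewrite leq_maxr].
- move=> b c; apply: le_max_approx => t /sh_lt[n Hn] /sh_lt[m Hm].
  pose N := maxn n m; apply: le_trans (le_sh _ N) _.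
  have := Hn N; have := Hm N; rewrite leq_maxl leq_maxr.
  rewrite !ltr_pdivrMr ?exprn_gt0 // => /(_ isT) h2 /(_ isT) h1.
  rewrite ler_pdivrMr ?exprn_gt0 // mulrBr.
  by apply: le_trans (sm_B Q _ _) _; rewrite ge_max !ltW.
- move=> s b Ss; have E n : q (a ^+ n * (s * b)) / q a ^+ n =
      Y s * (q (a ^+ n * b) / q a ^+ n).
    by rewrite [a ^+ n * _]mulrCA (sm_S Q _ Ss) mulrA.
  apply/eqP; rewrite eq_le; apply/andP; split.
    apply: le_mul_approx => // u t su /sh_lt[n /(_ n (leqnn _)) Hn].
    apply: le_trans (le_sh _ n) _; rewrite E.
    by apply: ler_pM => //; exact: ltW.
  by apply: le_shP => n; rewrite E ler_wpM2l.
Qed.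

(** A minimal seminorm is power-multiplicative, because it agrees with its
    spectral seminorm, and then multiplicative, because it agrees with its
    shifts. *)
Lemma minimal_mult q : sms q ->
  (forall q', sms q' -> (forall b, q' b <= q b) -> forall b, q b <= q' b) ->
  forall a b, q (a * b) = q a * q b.
Proof.
move=> Q minq a b.
have [/eqP|aN0] := eqVneq (q a) 0.
  rewrite eq_sym => /eqP a0; rewrite -a0 mul0r; apply/eqP.
  rewrite eq_le (sm_ge0 Q) andbT; apply: le_trans (sm_M Q _ _) _.
  by rewrite -a0 mul0r.
have a0 : 0 < q a by rewrite lt0r aN0 (sm_ge0 Q).
(* If [q (c ^+ 2)] were smaller than [q c ^+ 2], then so would be the spectral
   seminorm at [c]. *)
have sq c : 0 < q c -> q (c ^+ 2) = q c ^+ 2.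
  move=> c0; apply/eqP; rewrite eq_le sm_X //= leNgt; apply/negP => lt2.
  pose t := Num.max (Num.sqrt (q (c ^+ 2))) (q c / 2).
  have t0 : 0 < t by rewrite lt_max divr_gt0 ?orbT.
  have tc : t < q c.
    rewrite gt_max; apply/andP; split; last by lra.
    have <- : Num.sqrt (q c ^+ 2) = q c by rewrite sqrtr_sqr gtr0_norm.
    by rewrite ltr_sqrt // exprn_gt0.
  have ct : q (c ^+ 2) <= t ^+ 2.
    rewrite -[leLHS]sqr_sqrtr ?(sm_ge0 Q) //.
    have st : Num.sqrt (q (c ^+ 2)) <= t by rewrite le_max lexx.
    by rewrite lerXn2r ?nnegrE ?sqrtr_ge0 // ltW.
  have := minq _ (spectral_submult Q) (fun b => spectral_le_self b Q) c.
  apply/negP; rewrite -ltNge; apply: le_lt_trans (tc); apply: spectral_le.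
  split => //; exists (q c / t) => n.
  have c1 : 1 <= q c / t.
    by rewrite ler_pdivlMr // mul1r ltW.
  have E m : q (c ^+ m.*2) <= t ^+ m.*2.
    rewrite -mul2n !exprM; apply: le_trans (sm_X _ _ Q) _.
    by rewrite lerXn2r // nnegrE ?(sm_ge0 Q) // exprn_ge0 // ltW.
  rewrite -(odd_double_half n); case: odd; rewrite ?add0n ?add1n; last first.
    by apply: le_trans (E _) _; rewrite ler_peMl // exprn_ge0 // ltW.
  rewrite !exprS mulrA divfK ?gt_eqF //; apply: le_trans (sm_M Q _ _) _.
  by rewrite ler_wpM2l // (sm_ge0 Q).
have X2 n : q (a ^+ (2 ^ n)) = q a ^+ (2 ^ n).
  elim: n => [|n IH]; first by rewrite !expr1.
  by rewrite expnSr !exprM sq IH // exprn_gt0.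
have aX n : q (a ^+ n) = q a ^+ n.
  apply/eqP; rewrite eq_le sm_X //=.
  have /subnK E : (n <= 2 ^ n)%N by rewrite ltnW // ltn_expl.
  have := X2 n; rewrite -E !exprD => H.
  have := sm_M Q (a ^+ (2 ^ n - n)) (a ^+ n); rewrite H => H2.
  rewrite -(ler_pM2l (exprn_gt0 (2 ^ n - n) a0)); apply: le_trans H2 _.
  by rewrite ler_wpM2r ?(sm_ge0 Q) // sm_X.
have shle b' : shift q a b' <= q b'.
  apply: (@le_trans _ _ (q (a ^+ 0 * b') / q a ^+ 0)).
    apply: nneg_inf_le; last by exists 0%N.
    by move=> _ [n _ <-]; rewrite divr_ge0 ?exprn_ge0 ?(sm_ge0 Q).
  by rewrite !expr0 mul1r divr1.
have := minq _ (shift_submult Q a0 aX) shle b.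
move=> qs; apply/eqP; rewrite eq_le (sm_M Q) /=.
apply: le_trans (_ : q a * shift q a b <= _); first by rewrite ler_pM2l.
rewrite -ler_pdivlMl // mulrC.
apply: nneg_inf_le; last by exists 1%N => //; rewrite !expr1.
by move=> _ [n _ <-]; rewrite divr_ge0 ?exprn_ge0 ?(sm_ge0 Q).
Qed.

(** Nonemptiness of the spectrum: a submultiplicative seminorm dominates a
    multiplicative one. *)
Theorem exists_mult_seminorm q0 : sms q0 ->
  exists q, [/\ sms q, mult_seminorm q & forall b, q b <= q0 b].
Proof.
move=> Q0.
pose T := {q : B -> R | sms q /\ forall b, q b <= q0 b}.
pose le (s t : T) := `[< forall b, sval t b <= sval s b >].
have t0 : T by exists q0.
have [|x y z|C totC|] := @ZL_preorder T t0 le.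
- by move=> t; apply/asboolP.
- move=> /asboolP xy /asboolP yz; apply/asboolP => b.
  exact: le_trans (yz b) (xy b).
- have [[c0 Cc0]|C0] := pselect (C !=set0); last first.
    by exists t0 => s Cs; case: C0; exists s.
  pose E b := [set sval c b | c in C].
  have E0 b t : E b t -> 0 <= t.
    by move=> [[q [Q ?]] _ <-] /=; exact: sm_ge0 Q _.
  have EN b : E b !=set0 by exists (sval c0 b); exists c0.
  pose q b := inf (E b).
  have qle c b : C c -> q b <= sval c b.
    by move=> Cc; apply: nneg_inf_le; [exact: E0 | exists c].
  have qlt b t : q b < t -> exists2 c, C c & sval c b < t.
    by move=> /(nneg_inf_lt (EN b))[_ [c Cc <-]]; exists c.
  have q_ge b t : (forall c, C c -> t <= sval c b) -> t <= q b.
    by move=> H; apply: lb_le_inf => // _ [c Cc <-]; exact: H.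
  have qge0 b : 0 <= q b by apply: nneg_inf_ge0; exact: E0.
  (* two members of a chain have a common lower bound in it *)
  have lower c d : C c -> C d -> exists2 e, C e &
      (forall b, sval e b <= sval c b) /\ (forall b, sval e b <= sval d b).
    move=> Cc Cd; have [/asboolP H|/asboolP H] := totC _ _ Cc Cd.
      by exists d.
    by exists c.
  have SM (c : T) : sms (sval c) by case: c => ? [].
  have Q : sms q.
    split=> //.
    - apply/eqP; rewrite eq_le qge0 andbT; apply: le_trans (qle _ _ Cc0) _.
      by rewrite (sm_0 (SM c0)).
    - apply/eqP; rewrite eq_le; apply/andP; split.
        by apply: le_trans (qle _ _ Cc0) _; rewrite (sm_1 (SM c0)).
      by apply: q_ge => c _; rewrite (sm_1 (SM c)).
    - move=> a b; apply: le_mul_approx => // s t /qlt[c Cc cs] /qlt[d Cd dt].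
      have [e Ce [ec ed]] := lower _ _ Cc Cd.
      apply: le_trans (qle _ _ Ce) _; apply: le_trans (sm_M (SM e) _ _) _.
      apply: ler_pM; rewrite ?(sm_ge0 (SM e)) //; apply: ltW.
        exact: le_lt_trans (ec _) cs.
      exact: le_lt_trans (ed _) dt.
    - move=> a b; apply: le_max_approx => t /qlt[c Cc cs] /qlt[d Cd dt].
      have [e Ce [ec ed]] := lower _ _ Cc Cd.
      apply: le_trans (qle _ _ Ce) _; apply: le_trans (sm_B (SM e) _ _) _.
      rewrite ge_max; apply/andP; split; apply: ltW.
        exact: le_lt_trans (ec _) cs.
      exact: le_lt_trans (ed _) dt.
    - move=> s b Ss; apply/eqP; rewrite eq_le; apply/andP; split.
        apply: le_mul_approx => // u t su /qlt[c Cc ct].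
        apply: le_trans (qle _ _ Cc) _; rewrite (sm_S (SM c)) //.
        by apply: ler_pM; rewrite ?(sm_ge0 (SM c)) //; exact: ltW.
      apply: q_ge => c Cc; rewrite (sm_S (SM c)) //.
      by rewrite ler_wpM2l // qle.
  have Qle b : q b <= q0 b.
    apply: le_trans (qle _ _ Cc0) _; by case: (c0) => ? [].
  exists (exist _ q (conj Q Qle)) => c Cc; apply/asboolP => b /=; exact: qle.
- case=> q [Q qq0] qmin; exists q; split=> //; split.
  + exact: sm_ge0 Q.
  + exact: sm_0 Q.
  + exact: sm_1 Q.
  + apply: minimal_mult => // q' Q' q'q.
    have q'q0 b : q' b <= q0 b by apply: le_trans (q'q b) (qq0 b).
    have := qmin (exist _ q' (conj Q' q'q0)).
    by move=> /(_ (asboolT q'q))/asboolP.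
  + by move=> a b; exact: sm_D.
Qed.

End Spectrum.
(** * Gauss norms *)

Section UltrametricSums.
Context (R : realType) (A : comNzRingType) (q : A -> R) (Q : mult_seminorm q).

Lemma ms_submult : submult_seminorm set0 q q.
Proof.
have N b : q (- b) = q b.
  have : q (-1) ^+ 2 = 1 by rewrite expr2 -(ms_M Q) mulrNN mulr1 (ms_1 Q).
  move=> /eqP; rewrite sqrf_eq1 => /orP[|] /eqP q1.
    by rewrite -mulN1r (ms_M Q) q1 mul1r.
  by have := ms_ge0 Q (-1); rewrite q1 lerNr oppr0 ler10.
by split; [exact: ms_ge0 Q | exact: ms_0 Q | exact: ms_1 Q
  | by move=> a b; rewrite (ms_M Q)
  | by move=> a b; apply: le_trans (ms_D Q _ _) _; rewrite N
  | by []].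
Qed.

Lemma ms_N b : q (- b) = q b. Proof. exact: sm_N ms_submult. Qed.

Lemma ms_B a b : q (a - b) <= Num.max (q a) (q b).
Proof. exact: sm_B ms_submult a b. Qed.

Lemma ms_sum (I : Type) (r : seq I) (P : pred I) (F : I -> A) (M : R) :
  0 <= M -> (forall i, P i -> q (F i) <= M) ->
  q (\sum_(i <- r | P i) F i) <= M.
Proof. exact: sm_sum ms_submult. Qed.

Lemma ms_sum_lt (I : Type) (r : seq I) (P : pred I) (F : I -> A) (M : R) :
  0 < M -> (forall i, P i -> q (F i) < M) ->
  q (\sum_(i <- r | P i) F i) < M.
Proof.
move=> M0 FM; elim/big_ind : _ => //; first by rewrite (ms_0 Q).
by move=> x y xM yM; apply: le_lt_trans (ms_D Q _ _) _; rewrite gt_max xM.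
Qed.

Lemma ms_X a n : q (a ^+ n) = q a ^+ n.
Proof.
elim: n => [|n IH]; first by rewrite !expr0 (ms_1 Q).
by rewrite !exprS (ms_M Q) IH.
Qed.

(** The dominant term of a sum determines its seminorm. *)
Lemma ms_dominant a b : q b < q a -> q (a + b) = q a.
Proof.
move=> ba; apply/eqP; rewrite eq_le; apply/andP; split.
  by apply: le_trans (ms_D Q _ _) _; rewrite ge_max lexx ltW.
have : q a <= Num.max (q (a + b)) (q b) by rewrite -{1}(addrK b a) ms_B.
by rewrite le_max => /orP[//|]; rewrite leNgt ba.
Qed.

Lemma ms_dominantB a b : q b < q a -> q (a - b) = q a.
Proof. by move=> ba; rewrite ms_dominant // ms_N. Qed.

Lemma ms_distC a b : q (a - b) = q (b - a).
Proof. by rewrite -ms_N opprB. Qed.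

End UltrametricSums.

Section Gauss.
Context (R : realType) (A : comNzRingType) (y : A -> R) (r : R).
Hypotheses (Y : mult_seminorm y) (r_ge0 : 0 <= r).
Implicit Types (U V : {poly A}).

(** The Gauss norm of radius [r] on [A[X]] over the seminorm [y] of [A]. *)
Definition gauss U : R := \big[Num.max/0]_(i < size U) (y U`_i * r ^+ i).

Lemma gauss_term_ge0 U i : 0 <= y U`_i * r ^+ i.
Proof. by rewrite mulr_ge0 ?exprn_ge0 ?(ms_ge0 Y). Qed.

Lemma gauss_coef U i : y U`_i * r ^+ i <= gauss U.
Proof.
have [lti|gei] := ltnP i (size U).
  exact: (@le_bigmax _ _ _ 0 (fun j : 'I_(size U) => y U`_j * r ^+ j)
    (Ordinal lti)).
rewrite nth_default // (ms_0 Y) mul0r.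
rewrite /gauss; elim/big_ind : _ => [//|a b a0 _|a _].
  by rewrite le_max a0.
exact: gauss_term_ge0.
Qed.

Lemma gauss_ge0 U : 0 <= gauss U.
Proof. exact: le_trans (gauss_term_ge0 U 0) (gauss_coef U 0). Qed.

Lemma gauss_le U M : 0 <= M -> (forall i, y U`_i * r ^+ i <= M) -> gauss U <= M.
Proof. by move=> M0 UM; apply/bigmax_leP; split=> // i _; exact: UM. Qed.

Lemma gauss_lt U M : 0 < M -> (forall i, y U`_i * r ^+ i < M) -> gauss U < M.
Proof. by move=> M0 UM; apply/bigmax_ltP; split=> // i _; exact: UM. Qed.

Lemma gauss_dominant U : 0 < gauss U -> exists i, y U`_i * r ^+ i = gauss U.
Proof.
move=> U0; apply: contrapT => /forallNP H.
suff : gauss U < gauss U by rewrite ltxx.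
apply: gauss_lt => // i; rewrite lt_neqAle gauss_coef andbT.
by apply/negP => /eqP; exact: H.
Qed.

(** The largest, and below the smallest, index of a dominant term. Both are
    additive in products, which makes the Gauss norm multiplicative. *)
Definition last_dominant U l := y U`_l * r ^+ l = gauss U /\
  forall i, (l < i)%N -> y U`_i * r ^+ i < gauss U.

Definition first_dominant U l := y U`_l * r ^+ l = gauss U /\
  forall i, (i < l)%N -> y U`_i * r ^+ i < gauss U.

Lemma exists_first_dominant U : 0 < gauss U -> exists l, first_dominant U l.
Proof.
move=> /gauss_dominant ex.
have ex' : exists i, y U`_i * r ^+ i == gauss U by case: ex => i /eqP; exists i.
exists (ex_minn ex'); case: ex_minnP => l /eqP El minl; split=> // i il.
rewrite lt_neqAle gauss_coef andbT; apply: contraL il => /minl.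
by rewrite -leqNgt.
Qed.

Lemma exists_last_dominant U : 0 < gauss U -> exists l, last_dominant U l.
Proof.
move=> U0; have ex := gauss_dominant U0.
have ex' : exists i, y U`_i * r ^+ i == gauss U by case: ex => i /eqP; exists i.
have ub i : y U`_i * r ^+ i == gauss U -> (i <= size U)%N.
  move=> /eqP Ei; rewrite leqNgt; apply/negP => /ltnW gei.
  by move: U0; rewrite -Ei nth_default // (ms_0 Y) mul0r ltxx.
exists (ex_maxn ex' ub); case: ex_maxnP => l /eqP El maxl; split=> // i il.
rewrite lt_neqAle gauss_coef andbT; apply: contraL il => /maxl.
by rewrite -leqNgt.
Qed.

Lemma gauss0 : gauss 0 = 0.
Proof. by rewrite /gauss size_poly0 big_ord0. Qed.

Lemma gaussCXn a n : gauss (a%:P * 'X^n) = y a * r ^+ n.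
Proof.
apply/eqP; rewrite eq_le; apply/andP; split.
  apply: gauss_le => [|i]; first by rewrite mulr_ge0 ?exprn_ge0 ?(ms_ge0 Y).
  rewrite coefCM coefXn; case: eqP => [->|_]; first by rewrite mulr1.
  by rewrite mulr0 (ms_0 Y) mul0r mulr_ge0 ?exprn_ge0 ?(ms_ge0 Y).
by apply: le_trans (gauss_coef _ n); rewrite coefCM coefXn eqxx mulr1.
Qed.

Lemma gaussC a : gauss a%:P = y a.
Proof. by rewrite -[a%:P]mulr1 -(expr0 'X) gaussCXn mulr1. Qed.

Lemma gauss1 : gauss 1 = 1.
Proof. by rewrite gaussC (ms_1 Y). Qed.

Lemma gaussX : gauss 'X = r.
Proof. by rewrite -[X in gauss X]mul1r -['X]expr1 gaussCXn (ms_1 Y) mul1r. Qed.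

Lemma gaussD U V : gauss (U + V) <= Num.max (gauss U) (gauss V).
Proof.
apply: gauss_le => [|i]; first by rewrite le_max gauss_ge0.
have := ler_wpM2r (exprn_ge0 i r_ge0) (ms_D Y U`_i V`_i).
rewrite coefD maxr_pMl ?exprn_ge0 // => H; apply: le_trans H _.
by rewrite ge_max !le_max !gauss_coef orbT.
Qed.

Lemma gauss_mul_le U V : gauss (U * V) <= gauss U * gauss V.
Proof.
have g0 := mulr_ge0 (gauss_ge0 U) (gauss_ge0 V).
apply: gauss_le => // n; rewrite coefM.
have [->|rN0] := eqVneq (r ^+ n) 0; first by rewrite mulr0.
have rn0 : 0 < r ^+ n by rewrite lt0r rN0 exprn_ge0.
rewrite -ler_pdivlMr //; apply: ms_sum => //.
  by rewrite divr_ge0 ?exprn_ge0.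
move=> i _; rewrite ler_pdivlMr // (ms_M Y).
have -> : r ^+ n = r ^+ i * r ^+ (n - i) by rewrite -exprD subnKC // -ltnS.
by rewrite mulrACA ler_pM ?gauss_coef ?gauss_term_ge0.
Qed.

(** If among the products [U_a V_b] with [a + b = l + m] that of [U_l] and
    [V_m] is the only largest one, it is the value of the coefficient. *)
Lemma coef_mul_dominant U V l m : 0 < r -> 0 < y U`_l * y V`_m ->
  (forall a b, (a + b = l + m)%N -> a <> l ->
     (y U`_a * r ^+ a) * (y V`_b * r ^+ b) <
     (y U`_l * r ^+ l) * (y V`_m * r ^+ m)) ->
  y (U * V)`_(l + m) = y U`_l * y V`_m.
Proof.
move=> r0 p0 H; rewrite coefM.
have ltl : (l < (l + m).+1)%N by rewrite ltnS leq_addr.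
rewrite (bigD1 (Ordinal ltl)) //= addKn ms_dominant // (ms_M Y) //.
apply: ms_sum_lt => // i iNl; rewrite (ms_M Y).
have il : (i : nat) <> l by move=> E; move/eqP: iNl; apply; exact: val_inj.
have E : (i + (l + m - i) = l + m)%N by rewrite subnKC // -ltnS.
have := H _ _ E il; rewrite mulrACA [ltRHS]mulrACA -!exprD E.
by rewrite ltr_pM2r // exprn_gt0.
Qed.

Lemma last_dominant_mul U V l m : 0 < r -> 0 < gauss U -> 0 < gauss V ->
  last_dominant U l -> last_dominant V m ->
  y (U * V)`_(l + m) * r ^+ (l + m) = gauss U * gauss V.
Proof.
move=> r0 U0 V0 [El Hl] [Em Hm].
rewrite -El -Em [RHS]mulrACA -exprD coef_mul_dominant //.
  rewrite -(pmulr_lgt0 _ (exprn_gt0 (l + m) r0)) exprD mulrACA El Em.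
  exact: mulr_gt0.
move=> a b ab al; rewrite El Em; have [la|la] := ltnP l a.
  apply: (@le_lt_trans _ _ (y U`_a * r ^+ a * gauss V)).
    by rewrite ler_wpM2l ?gauss_term_ge0 ?gauss_coef.
  by rewrite ltr_pM2r // Hl.
have mb : (m < b)%N by move: la ab al; lia.
apply: (@le_lt_trans _ _ (gauss U * (y V`_b * r ^+ b))).
  by rewrite ler_wpM2r ?gauss_term_ge0 ?gauss_coef.
by rewrite ltr_pM2l // Hm.
Qed.

Lemma first_dominant_mul U V l m : 0 < r -> 0 < gauss U -> 0 < gauss V ->
  first_dominant U l -> first_dominant V m ->
  y (U * V)`_(l + m) * r ^+ (l + m) = gauss U * gauss V.
Proof.
move=> r0 U0 V0 [El Hl] [Em Hm].
rewrite -El -Em [RHS]mulrACA -exprD coef_mul_dominant //.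
  rewrite -(pmulr_lgt0 _ (exprn_gt0 (l + m) r0)) exprD mulrACA El Em.
  exact: mulr_gt0.
move=> a b ab al; rewrite El Em; have [la|la] := ltnP a l.
  apply: (@le_lt_trans _ _ (y U`_a * r ^+ a * gauss V)).
    by rewrite ler_wpM2l ?gauss_term_ge0 ?gauss_coef.
  by rewrite ltr_pM2r // Hl.
have mb : (b < m)%N by move: la ab al; lia.
apply: (@le_lt_trans _ _ (gauss U * (y V`_b * r ^+ b))).
  by rewrite ler_wpM2r ?gauss_term_ge0 ?gauss_coef.
by rewrite ltr_pM2l // Hm.
Qed.

Lemma gaussM U V : gauss (U * V) = gauss U * gauss V.
Proof.
apply/eqP; rewrite eq_le gauss_mul_le /=.
have [r0|rn] := ltP 0 r; last first.
  have r0 : r = 0 by apply/eqP; rewrite eq_le rn.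
  have g0 W : gauss W = y W`_0.
    apply/eqP; rewrite eq_le -{2}[y W`_0]mulr1 -(expr0 r) gauss_coef andbT.
    apply: gauss_le => [|[|i]]; rewrite ?(ms_ge0 Y) ?expr0 ?mulr1 //.
    by rewrite r0 expr0n mulr0 (ms_ge0 Y).
  by rewrite !g0 coef0M (ms_M Y).
have [U0|U0] := ltP 0 (gauss U); last first.
  by rewrite (le_trans _ (gauss_ge0 _)) // mulr_le0_ge0 // gauss_ge0.
have [V0|V0] := ltP 0 (gauss V); last first.
  by rewrite (le_trans _ (gauss_ge0 _)) // mulr_ge0_le0 // gauss_ge0.
have [l Hl] := exists_last_dominant U0.
have [m Hm] := exists_last_dominant V0.
by rewrite -(last_dominant_mul r0 U0 V0 Hl Hm) gauss_coef.
Qed.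

Lemma gauss_mult_seminorm : mult_seminorm gauss.
Proof.
by split; [exact: gauss_ge0|exact: gauss0|exact: gauss1|exact: gaussM
  |exact: gaussD].
Qed.

(** A polynomial with two dominant terms does not divide a perturbation of a
    monomial. *)
Lemma gauss_monomial_sub U V a n i j : 0 < r -> 0 < y a -> (i < j)%N ->
  y U`_i * r ^+ i = gauss U -> y U`_j * r ^+ j = gauss U -> 0 < gauss U ->
  gauss (a%:P * 'X^n) <= gauss (a%:P * 'X^n - U * V).
Proof.
move=> r0 a0 ij Ei Ej U0; rewrite leNgt; apply/negP => lt.
set s := a%:P * 'X^n in lt.
have s0 : 0 < gauss s by rewrite gaussCXn mulr_gt0 ?exprn_gt0.
have Es : gauss (U * V) = gauss s.
  rewrite -[U * V](subKr s).
  by rewrite (ms_dominantB gauss_mult_seminorm).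
have V0 : 0 < gauss V by rewrite -(pmulr_rgt0 _ U0) -gaussM Es.
(* the only dominant index of the product is [n] *)
have only k : y (U * V)`_k * r ^+ k = gauss U * gauss V -> k = n.
  rewrite -gaussM Es => Ek; apply/eqP; apply: contraPT lt => kn.
  apply/negP; rewrite -leNgt -Ek.
  apply: le_trans (gauss_coef _ k); rewrite coefB coefCM coefXn.
  by rewrite (negPf kn) mulr0 sub0r (ms_N Y).
have [l Hl] := exists_last_dominant U0.
have [l' Hl'] := exists_last_dominant V0.
have [f Hf] := exists_first_dominant U0.
have [f' Hf'] := exists_first_dominant V0.
have /only Ln := last_dominant_mul r0 U0 V0 Hl Hl'.
have /only Fn := first_dominant_mul r0 U0 V0 Hf Hf'.
have fi : (f <= i)%N.
  by rewrite leqNgt; apply/negP => /(proj2 Hf); rewrite Ei ltxx.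
have jl : (j <= l)%N.
  by rewrite leqNgt; apply/negP => /(proj2 Hl); rewrite Ej ltxx.
have fl' : (f' <= l')%N.
  by rewrite leqNgt; apply/negP => /(proj2 Hf'); rewrite (proj1 Hl') ltxx.
lia.
Qed.

End Gauss.
(** * Zeros of power series *)

Section Zeros.
Context (R : realType) (A : comNzRingType) (y : A -> R) (r : R) (g : nat -> A).
Hypotheses (Y : mult_seminorm y) (r0 : 0 < r).
Hypothesis g_cvg : forall e, 0 < e ->
  exists N, forall n, (N <= n)%N -> y (g n) * r ^+ n <= e.
Variables (i j : nat).
Hypotheses (ij : (i < j)%N) (gi0 : 0 < y (g i) * r ^+ i)
  (gj : y (g j) * r ^+ j = y (g i) * r ^+ i)
  (g_le : forall n, y (g n) * r ^+ n <= y (g i) * r ^+ i).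
Implicit Types (b H : {poly A}).

Local Notation nrm := (gauss y r).
Local Notation G n := (\poly_(m < n) g m).
Let r_ge0 : 0 <= r. Proof. exact: ltW. Qed.
Let M : mult_seminorm nrm. Proof. exact: gauss_mult_seminorm. Qed.

(** The monomials with coefficient outside of the kernel of [y]. The zero found
    below agrees on them with the Gauss norm, so it lies over [y] and on the
    circle of radius [r]. *)
Definition monomials : set {poly A} :=
  [set s | exists a n, 0 < y a /\ s = a%:P * 'X^n].

(** Upper bounds for the quotient seminorm of [b] modulo the series [g], in the
    localization at the monomials. *)
Definition quotient_bounds b : set R := [set t | 0 <= t /\
  exists s N, monomials s /\ forall n, (N <= n)%N ->
    exists H, nrm (s * b - G n * H) <= t * nrm s].

Definition quotient_norm b : R := inf (quotient_bounds b).

Lemma monomials_gt0 s : monomials s -> 0 < nrm s.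
Proof.
by move=> [a [n [a0 ->]]]; rewrite gaussCXn // mulr_gt0 // exprn_gt0.
Qed.

Lemma monomialsC a : 0 < y a -> monomials a%:P.
Proof. by move=> a0; exists a, 0%N; rewrite expr0 mulr1. Qed.

Lemma monomials1 : monomials 1.
Proof. by apply: monomialsC; rewrite (ms_1 Y). Qed.

Lemma monomialsX : monomials 'X.
Proof. by exists 1, 1%N; rewrite (ms_1 Y) expr1 mul1r. Qed.

Lemma monomialsM s t : monomials s -> monomials t -> monomials (s * t).
Proof.
move=> [a [n [a0 ->]]] [b [m [b0 ->]]]; exists (a * b), (n + m)%N.
by rewrite (ms_M Y) mulr_gt0 // polyCM exprD mulrACA.
Qed.

Lemma quotient_bounds_ge0 b t : quotient_bounds b t -> 0 <= t.
Proof. by case. Qed.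

Lemma quotient_boundsW b s t : quotient_bounds b s -> s <= t ->
  quotient_bounds b t.
Proof.
move=> [s0 [c [N [Sc HN]]]] st; split; first exact: le_trans st.
exists c, N; split=> // n /HN[H HH]; exists H; apply: le_trans HH _.
by rewrite ler_wpM2r // ltW // monomials_gt0.
Qed.

Lemma quotient_bounds_self b : quotient_bounds b (nrm b).
Proof.
split; first exact: gauss_ge0.
exists 1, 0%N; split; first exact: monomials1.
by move=> n _; exists 0; rewrite mulr0 subr0 mul1r gauss1 // mulr1.
Qed.

Lemma quotient_norm_le b t : quotient_bounds b t -> quotient_norm b <= t.
Proof. by apply: nneg_inf_le => s /quotient_bounds_ge0. Qed.

Lemma quotient_norm_ge0 b : 0 <= quotient_norm b.
Proof. by apply: nneg_inf_ge0 => s /quotient_bounds_ge0. Qed.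

Lemma quotient_norm_lt b t : quotient_norm b < t -> quotient_bounds b t.
Proof.
move=> /nneg_inf_lt[|s bs st].
  by exists (nrm b); exact: quotient_bounds_self.
by apply: quotient_boundsW bs _; exact: ltW.
Qed.

(** The truncations of [g] have two dominant terms, so they do not divide a
    perturbation of a monomial. *)
Lemma quotient_norm1_ge1 : 1 <= quotient_norm 1.
Proof.
apply: lb_le_inf; first by exists (nrm 1); exact: quotient_bounds_self.
move=> t [t0 [s [N [Ss HN]]]]; rewrite leNgt; apply/negP => t1.
have s0 := monomials_gt0 Ss.
have [H] := HN (maxn N j.+1) (leq_maxl _ _); set n := maxn N j.+1.
have jn : (j < n)%N by rewrite leq_maxr.
have coefG m : (m < n)%N -> (G n)`_m = g m by move=> mn; rewrite coef_poly mn.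
have GE : nrm (G n) = y (g i) * r ^+ i.
  apply/eqP; rewrite eq_le; apply/andP; split.
    apply: gauss_le => [|m]; first exact: ltW.
    rewrite coef_poly; case: ifP => // _; rewrite (ms_0 Y) mul0r; exact: ltW.
  rewrite -[in leLHS](coefG i) ?gauss_coef //; exact: ltn_trans ij jn.
have [a [m [a0 Es]]] := Ss.
apply/negP; rewrite -ltNge mulr1; apply: (@lt_le_trans _ _ (nrm s)).
  by rewrite gtr_pMl.
rewrite Es; apply: (gauss_monomial_sub Y r_ge0 H m r0 a0 ij).
- by rewrite coefG ?GE // (ltn_trans ij jn).
- by rewrite coefG ?GE.
- by rewrite GE.
Qed.

Lemma quotient_norm_submult : submult_seminorm monomials nrm quotient_norm.
Proof.
have MM u v : nrm (u * v) = nrm u * nrm v := ms_M M u v.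
split.
- exact: quotient_norm_ge0.
- apply/eqP; rewrite eq_le quotient_norm_ge0 andbT -[leRHS](gauss0 y r).
  exact/quotient_norm_le/quotient_bounds_self.
- apply/eqP; rewrite eq_le quotient_norm1_ge1 andbT -[leRHS](gauss1 Y r_ge0).
  exact/quotient_norm_le/quotient_bounds_self.
- move=> a b; apply: le_mul_approx; rewrite ?quotient_norm_ge0 // => s t.
  move=> /quotient_norm_lt[s0 [c [N [Sc HN]]]].
  move=> /quotient_norm_lt[t0 [d [N' [Sd HN']]]].
  apply: quotient_norm_le; split; first exact: mulr_ge0.
  exists (c * d), (maxn N N'); split; first exact: monomialsM.
  move=> n; rewrite geq_max => /andP[/HN[H HH] /HN'[H' HH']].
  exists (H * (d * b) + H' * (c * a) - G n * H * H').
  have -> : c * d * (a * b) -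
      G n * (H * (d * b) + H' * (c * a) - G n * H * H') =
      (c * a - G n * H) * (d * b - G n * H') by ring.
  by rewrite !MM mulrACA ler_pM // ?(ms_ge0 M).
- move=> a b; apply: le_max_approx => t.
  move=> /quotient_norm_lt[t0 [c [N [Sc HN]]]].
  move=> /quotient_norm_lt[_ [d [N' [Sd HN']]]].
  apply: quotient_norm_le; split => //.
  exists (c * d), (maxn N N'); split; first exact: monomialsM.
  move=> n; rewrite geq_max => /andP[/HN[H HH] /HN'[H' HH']].
  exists (d * H - c * H').
  have -> : c * d * (a - b) - G n * (d * H - c * H') =
      d * (c * a - G n * H) - c * (d * b - G n * H') by ring.
  apply: le_trans (ms_B M _ _) _; rewrite ge_max !MM; apply/andP; split.
    by rewrite mulrA mulrC ler_wpM2r // (ms_ge0 M).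
  by rewrite mulrCA ler_wpM2l // (ms_ge0 M).
- move=> s b Ss; have s0 := monomials_gt0 Ss.
  apply/eqP; rewrite eq_le; apply/andP; split.
    apply: le_mul_approx; rewrite ?quotient_norm_ge0 ?ltW // => u t su.
    move=> /quotient_norm_lt[t0 [c [N [Sc HN]]]].
    apply: (@le_trans _ _ (nrm s * t)); last by rewrite ler_wpM2r // ltW.
    apply: quotient_norm_le; split; first by rewrite mulr_ge0 // ltW.
    exists c, N; split=> // n /HN[H HH]; exists (s * H).
    have -> : c * (s * b) - G n * (s * H) = s * (c * b - G n * H) by ring.
    by rewrite MM -mulrA ler_wpM2l // ltW.
  rewrite -ler_pdivlMl //; apply/ler_addgt0Pr => e e0.
  have : quotient_norm (s * b) < quotient_norm (s * b) + nrm s * e.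
    by rewrite ltrDl mulr_gt0.
  move=> /quotient_norm_lt[t0 [c [N [Sc HN]]]].
  have -> : (nrm s)^-1 * quotient_norm (s * b) + e =
            (quotient_norm (s * b) + nrm s * e) / nrm s.
    by field; rewrite gt_eqF.
  apply: quotient_norm_le; split; first by rewrite divr_ge0 // ltW.
  exists (c * s), N; split; first exact: monomialsM.
  move=> n /HN[H HH]; exists H; rewrite -mulrA; apply: le_trans HH _.
  by rewrite MM [nrm c * _]mulrC mulrA divfK ?gt_eqF.
Qed.

(** A power series with two dominant terms on the circle of radius [r] has a
    zero there. *)
Lemma exists_zero : exists q : {poly A} -> R,
  [/\ mult_seminorm q, forall b, q b <= nrm b, forall a, q a%:P = y a,
      q 'X = r & (fun n => q (G n)) @ \oo --> (0 : R)].
Proof.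
have [q [SM Q q_le]] :=
  exists_mult_seminorm (ms_ge0 M) quotient_norm_submult.
have qle b : q b <= nrm b.
  exact/(le_trans (q_le b))/quotient_norm_le/quotient_bounds_self.
have qS s : monomials s -> q s = nrm s.
  by move=> Ss; rewrite -[s]mulr1 (sm_S SM) // (ms_1 Q) !mulr1.
exists q; split=> //.
- move=> a; have [a0|a0] := ltP 0 (y a).
    by rewrite qS ?gaussC //; exact: monomialsC.
  have /eqP ya : y a == 0 by rewrite eq_le a0 (ms_ge0 Y).
  by apply/eqP; rewrite ya eq_le (ms_ge0 Q) andbT -ya -(gaussC Y r_ge0) qle.
- by rewrite qS ?gaussX //; exact: monomialsX.
- apply/cvgrPdist_le => e e0; have [N HN] := g_cvg e0.
  exists N => // m /= Nm; rewrite sub0r normrN ger0_norm ?(ms_ge0 Q) //.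
  apply: le_trans (q_le _) _; apply: quotient_norm_le; split; first exact: ltW.
  exists 1, m; split; first exact: monomials1.
  move=> n mn; exists 1; rewrite mul1r mulr1 gauss1 // mulr1.
  apply: gauss_le => [|l]; first exact: ltW.
  rewrite coefB !coef_poly; have [lm|ml] := ltnP l m.
    by rewrite (leq_trans lm mn) subrr (ms_0 Y) mul0r ltW.
  rewrite sub0r (ms_N Y); case: ifP => _; last by rewrite (ms_0 Y) mul0r ltW.
  by apply: HN; exact: leq_trans ml.
Qed.

End Zeros.
(** * Points of the affine line *)

Lemma bernoulli_ge (R : realType) (d : R) n : 0 <= d ->
  1 + n%:R * d <= (1 + d) ^+ n.
Proof.
move=> d0; elim: n => [|n IH]; first by rewrite mul0r addr0 expr0.
rewrite exprS; apply: (@le_trans _ _ ((1 + d) * (1 + n%:R * d))).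
  rewrite -natr1; have : 0 <= n%:R * d * d by rewrite !mulr_ge0.
  nra.
by rewrite ler_wpM2l // addr_ge0.
Qed.

(** Linear growth does not compensate a geometric factor. *)
Lemma le_of_linear_growth (R : realType) (a b : R) : 0 <= a -> 0 <= b ->
  (forall n, a ^+ n <= n.+1%:R * b ^+ n) -> a <= b.
Proof.
move=> a0 b0 H; rewrite leNgt; apply/negP => ba.
have [b00|bN0] := eqVneq b 0.
  by have := H 1%N; rewrite b00 !expr1 mulr0 leNgt -b00 ba.
have bp : 0 < b by rewrite lt0r bN0.
pose c := Num.sqrt (a / b); pose d := c - 1.
have c1 : 1 < c.
  have : Num.sqrt 1 < c.
    have ab0 : 0 < a / b by rewrite divr_gt0 // (lt_trans bp).
    by rewrite ltr_sqrt // ltr_pdivlMr // mul1r.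
  by rewrite sqrtr1.
have d0 : 0 < d by rewrite subr_gt0.
have Ha n : (c ^+ n) ^+ 2 <= n.+1%:R.
  rewrite exprAC sqr_sqrtr ?divr_ge0 // expr_div_n.
  by rewrite ler_pdivrMr ?exprn_gt0.
have [n Hn] : exists n : nat, d ^- 2 < n%:R.
  exists (Num.bound (d ^- 2)); apply: archi_boundP.
  by rewrite invr_ge0 exprn_ge0 // ltW.
have n2 : 1 < n%:R * d ^+ 2 by rewrite -ltr_pdivrMr ?exprn_gt0 // div1r.
have := Ha n; rewrite leNgt => /negP; apply.
have B := bernoulli_ge n (ltW d0); rewrite -[1 + d]/(1 + (c - 1)) in B.
rewrite [1 + (c - 1)]addrC subrK in B.
have n0 : (0 : R) <= n%:R by [].
have nd : 0 <= n%:R * d by rewrite mulr_ge0 // ltW.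
apply: (@lt_le_trans _ _ ((1 + n%:R * d) ^+ 2)); last first.
  rewrite lerXn2r // nnegrE // ?addr_ge0 //.
  by rewrite exprn_ge0 // ltW // (lt_trans ltr01).
rewrite -natr1 sqrrD expr1n mul1r exprMn.
have : n%:R <= n%:R * (n%:R * d ^+ 2).
  have [->|/eqP n00] := eqVneq n 0%N; first by rewrite mul0r.
  by rewrite ler_peMr // ltW.
have : 0 < n%:R * d.
  by rewrite mulr_gt0 // ltr0n; case: (n) n2 => //; rewrite mul0r ltr10.
by lra.
Qed.

Lemma ptws_cvgP (R : realType) (I : eqType) (F : set_system {ptws I -> R})
    (u : {ptws I -> R}) : Filter F ->
  F --> u <-> forall i, (fun w : {ptws I -> R} => w i) @ F --> u i.
Proof.
move=> FF; split=> [Fu i|H].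
  apply: cvg_trans (@proj_continuous I (fun=> R) i u).
  exact: cvg_app Fu.
apply/cvg_sup => i U [/= _ [[V /= oV <-] Vu]] /filterS; apply.
by apply: H; exact: open_nbhs_nbhs.
Qed.

Lemma fmap_ultra (S T : Type) (h : S -> T) (F : set_system S) :
  UltraFilter F -> UltraFilter (h @ F).
Proof.
move=> FU; have FP := @ultra_proper _ _ FU.
split; first exact: fmap_proper_filter.
move=> G GP FG; apply/seteqP; split=> [A GA|]; last exact: FG.
have [//|FnA] := in_ultra_setVsetC (h @^-1` A) FU.
have GnA : G (~` A) by apply: FG.
by have [x []] := filter_ex (filterI GA GnA).
Qed.

Section RealLimits.
Context (R : realType) (T : Type) (F : set_system T) (FF : ProperFilter F).
Implicit Types (h : T -> R) (a b : R).

Lemma real_cvg_unique h a b : h @ F --> a -> h @ F --> b -> a = b.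
Proof.
by move=> /(cvg_lim (@Rhausdorff R)) <- /(cvg_lim (@Rhausdorff R)) <-.
Qed.

Lemma real_cvg_le h a b : h @ F --> a ->
  (\forall t \near F, h t <= b) -> a <= b.
Proof.
move=> ha hb; rewrite -(cvg_lim (@Rhausdorff R) ha).
by apply: limr_le => //; apply/cvg_ex; exists a.
Qed.

Lemma real_cvg_ge h a b : h @ F --> a ->
  (\forall t \near F, b <= h t) -> b <= a.
Proof.
move=> ha hb; rewrite -(cvg_lim (@Rhausdorff R) ha).
by apply: limr_ge => //; apply/cvg_ex; exists a.
Qed.

End RealLimits.

Section Points.
Context (R : realType) (k : fieldType) (v : nonarch_absval R k).
Implicit Types (x y z : A1an v) (P : {poly k}).

Lemma absv_mult_seminorm : mult_seminorm v.
Proof.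
have v0 : v 0 = 0 by apply/absv_eq0.
have v1 : v 1 = 1.
  have : v 1 * v 1 = v 1 * 1 by rewrite -absvM !mulr1.
  apply/mulfI/eqP => /absv_eq0/eqP; by rewrite oner_eq0.
by split=> //; [exact: absv_ge0 | exact: absvM | exact: absvD].
Qed.

Lemma A1an_eq x y : (forall P, x P = y P) -> x = y.
Proof.
case: x y => [f f0 fC fM fD] [g g0 gC gM gD] /= /funext fg.
by rewrite fg in f0 fC fM fD *; congr A1An; exact: Prop_irrelevance.
Qed.

Lemma ble_anti x y : ble x y -> ble y x -> x = y.
Proof. by move=> xy yx; apply: A1an_eq => P; apply/le_anti; rewrite xy yx. Qed.

Lemma sn_mult_seminorm x : mult_seminorm x.
Proof.
have V := absv_mult_seminorm.
have x0 : x 0 = 0 by rewrite -[0]/(0%:P) snC (ms_0 V).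
have x1 : x 1 = 1 by rewrite -[1]/(1%:P) snC (ms_1 V).
split=> //; [exact: sn_ge0 | exact: snM |] => P Q.
have xX S n : x (S ^+ n) = x S ^+ n.
  by elim: n => [|n IH]; rewrite ?expr0 // !exprS snM IH.
set M := Num.max _ _.
have M0 : 0 <= M by rewrite le_max sn_ge0.
have vn n : v n%:R <= 1.
  elim: n => [|n IH]; first by rewrite (ms_0 V).
  rewrite -natr1; apply: le_trans (ms_D V _ _) _.
  by rewrite ge_max IH (ms_1 V) lexx.
apply: le_of_linear_growth; rewrite ?sn_ge0 // => n.
rewrite -xX exprDn.
have S (I : Type) (r : seq I) (F : I -> {poly k}) :
    x (\sum_(i <- r) F i) <= \sum_(i <- r) x (F i).
  elim/big_ind2 : _ => //; first by rewrite x0.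
  by move=> a b c d ab cd; apply: le_trans (snD _ _ _) _; rewrite lerD.
apply: le_trans (S _ _ _) _.
apply: (@le_trans _ _ (\sum_(i < n.+1) M ^+ n)); last first.
  by rewrite sumr_const card_ord mulr_natl.
apply: ler_sum => i _; rewrite -mulr_natr -polyC_natr snM snC.
apply: (@le_trans _ _ (x (P ^+ (n - i) * Q ^+ i) * 1)).
  by rewrite ler_wpM2l ?sn_ge0.
rewrite mulr1 snM !xX; have -> : M ^+ n = M ^+ (n - i) * M ^+ i.
  by rewrite -exprD subnK // -ltnS.
by apply: ler_pM; rewrite ?exprn_ge0 ?sn_ge0 // lerXn2r ?nnegrE ?sn_ge0 //
  le_max lexx ?orbT.
Qed.

Lemma max_le_add (a b : R) : 0 <= a -> 0 <= b -> Num.max a b <= a + b.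
Proof. by move=> a0 b0; rewrite ge_max lerDl b0 lerDr a0. Qed.

(** A multiplicative ultrametric seminorm extending [v], as a point. *)
Definition mk_point (q : {poly k} -> R) (Q : mult_seminorm q)
    (qC : forall c, q c%:P = v c) : A1an v :=
  A1An (ms_ge0 Q) qC (ms_M Q)
    (fun P S => le_trans (ms_D Q P S)
       (max_le_add (ms_ge0 Q P) (ms_ge0 Q S))).

Lemma snXn x n : x ('X^n) = x 'X ^+ n.
Proof. exact: ms_X (sn_mult_seminorm x) _ _. Qed.

(** The Gauss point of center [0] and radius [r]; the absolute value makes it
    total in [r]. *)
Lemma etaC_subproof (r : R) (c : k) : gauss v `|r| c%:P = v c.
Proof. exact: gaussC absv_mult_seminorm (normr_ge0 r) c. Qed.

Definition eta (r : R) : A1an v :=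
  mk_point (gauss_mult_seminorm absv_mult_seminorm (normr_ge0 r))
    (etaC_subproof r).

Lemma etaE r P : 0 <= r -> eta r P = gauss v r P.
Proof. by move=> r0; rewrite /= ger0_norm. Qed.

Lemma etaX r : 0 <= r -> eta r 'X = r.
Proof. by move=> r0; rewrite etaE // gaussX //; exact: absv_mult_seminorm. Qed.

Lemma eta_coef r P i : 0 <= r -> v P`_i * r ^+ i <= eta r P.
Proof.
by move=> r0; rewrite etaE // gauss_coef //; exact: absv_mult_seminorm.
Qed.

Lemma eta_le r P M : 0 <= r -> 0 <= M ->
  (forall i, v P`_i * r ^+ i <= M) -> eta r P <= M.
Proof. by move=> r0 M0 H; rewrite etaE // gauss_le. Qed.

Lemma eta_gt0 r P : 0 < r -> P != 0 -> 0 < eta r P.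
Proof.
move=> r0 P0; apply: (@lt_le_trans _ _ (v P`_((size P).-1) * r ^+ (size P).-1)).
  rewrite mulr_gt0 ?exprn_gt0 // lt0r absv_ge0 andbT.
  apply/eqP => /absv_eq0/eqP.
  by rewrite -/(lead_coef P) lead_coef_eq0 (negPf P0).
by apply: eta_coef; exact: ltW.
Qed.

(** Gauss points dominate all the points of the disc. *)
Lemma ble_eta x r : x 'X <= r -> ble x (eta r).
Proof.
move=> xr P; have x0 : 0 <= x 'X := sn_ge0 _ _; have r0 := le_trans x0 xr.
rewrite -{1}[P]coefK poly_def; apply: (ms_sum (sn_mult_seminorm x)).
  exact: sn_ge0.
move=> i _; rewrite -mul_polyC snM snC snXn.
apply: le_trans (eta_coef P i r0); rewrite ler_wpM2l ?absv_ge0 //.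
by rewrite lerXn2r.
Qed.

Lemma blt_eta x r : x 'X < r -> blt x (eta r).
Proof.
move=> xr; split; first exact/ble_eta/ltW.
have r0 : 0 <= r by apply: le_trans (ltW xr); exact: sn_ge0.
by move=> E; move: xr; rewrite E etaX ?ltxx.
Qed.

(** The translate [P(X + T)], as a polynomial in [X] over [k[T]]. *)
Definition translate P : {poly {poly k}} := map_poly polyC P \Po ('X + 'X%:P).

Lemma translate_coef0 P : (translate P)`_0 = P.
Proof.
rewrite -horner_coef0 /translate horner_comp !hornerE.
exact: comp_polyXr.
Qed.

Section Thickening.
Variable x : A1an v.
Let X := sn_mult_seminorm x.

Lemma thicken_subproof (t : R) :
  mult_seminorm (fun P => gauss x `|t| (translate P)).
Proof.
have G := gauss_mult_seminorm X (normr_ge0 t); split.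
- by move=> P; exact: ms_ge0 G _.
- by rewrite /translate rmorph0 comp_poly0; exact: ms_0 G.
- by rewrite /translate rmorph1 -[1]/(1%:P) comp_polyC; exact: ms_1 G.
- by move=> P Q; rewrite /translate rmorphM comp_polyM; exact: ms_M G _ _.
- by move=> P Q; rewrite /translate rmorphD comp_polyD; exact: ms_D G _ _.
Qed.

Lemma thickenC_subproof (t : R) (c : k) : gauss x `|t| (translate c%:P) = v c.
Proof. by rewrite /translate map_polyC comp_polyC gaussC // snC. Qed.

(** The point [x] enlarged to radius [t]: the segment from [x] to infinity. *)
Definition thicken (t : R) : A1an v :=
  mk_point (thicken_subproof t) (thickenC_subproof t).

Lemma thicken_ge t : ble x (thicken t).
Proof.
move=> P /=; rewrite -{1}[P]translate_coef0 -[leLHS]mulr1 -(expr0 `|t|).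
exact: gauss_coef.
Qed.

Lemma thicken0 : thicken 0 = x.
Proof.
apply: ble_anti (thicken_ge 0) => P /=; rewrite normr0.
apply: gauss_le => [|[|i]]; first exact: sn_ge0.
  by rewrite translate_coef0 mulr1.
by rewrite exprS mul0r mulr0 sn_ge0.
Qed.

Lemma thicken_eta t : x 'X <= t -> thicken t = eta t.
Proof.
move=> xt; have t0 : 0 <= t by apply: le_trans xt; exact: sn_ge0.
have G := gauss_mult_seminorm X t0.
apply: ble_anti => [|P].
  apply: ble_eta; rewrite /= ger0_norm // /translate map_polyX comp_polyX.
  by apply: le_trans (ms_D G _ _) _; rewrite gaussX // gaussC // ge_max lexx.
rewrite etaE //= ger0_norm //.
(* translating back by [- T] does not increase the Gauss norm of radius [t] *)
have -> : gauss v t P = gauss x t (translate P \Po ('X - 'X%:P)).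
  rewrite /translate -comp_polyA comp_polyD comp_polyX comp_polyC subrK.
  rewrite comp_polyXr; apply/eqP; rewrite eq_le; apply/andP; split.
    apply: gauss_le => [|i]; first exact: ms_ge0 G _.
    apply: le_trans (gauss_coef X t0 _ i); rewrite coef_map /= snC //.
  apply: gauss_le => [|i]; first exact: gauss_ge0 absv_mult_seminorm t0 _.
  by rewrite coef_map /= snC gauss_coef //; exact: absv_mult_seminorm.
set U := translate P; rewrite comp_polyE; apply: (ms_sum G).
  exact: ms_ge0 G _.
move=> i _; rewrite -mul_polyC (ms_M G) gaussC // (ms_X G).
apply: le_trans (gauss_coef X t0 U i).
rewrite ler_wpM2l ?sn_ge0 // lerXn2r ?nnegrE ?(ms_ge0 G) //.
by apply: le_trans (ms_B G _ _) _; rewrite gaussX // gaussC // ge_max lexx.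
Qed.

End Thickening.

Lemma gauss_norm_continuous (A : comNzRingType) (y : A -> R) (U : {poly A}) :
  continuous (fun t : R => gauss y `|t| U).
Proof.
rewrite /gauss; elim: (index_enum _) => [|i r IH] t.
  under eq_fun do rewrite big_nil.
  exact: cvg_cst.
under eq_fun do rewrite big_cons.
apply: (@continuous_max _ _ (fun t : R => y U`_i * `|t| ^+ i)); last exact: IH.
apply: cvgM; first exact: cvg_cst.
apply: (@continuous_comp _ _ _ (fun t : R => `|t|) (fun s : R => s ^+ i)).
  exact: norm_continuous.
exact: exprn_continuous.
Qed.

(** * Topology of the affine line *)

Lemma sn_continuous P : continuous (fun x : A1an v => x P).
Proof.
move=> x U xU; pose h (z : A1an v) : {ptws {poly k} -> R} := sn z.
have hU := @proj_continuous {poly k} (fun=> R) P (h x) U xU.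
exact: (@initial_continuous _ _ h x _ hU).
Qed.

Lemma A1an_cvg (F : set_system (A1an v)) x : Filter F ->
  (forall P, (fun z : A1an v => z P) @ F --> x P) -> F --> x.
Proof.
move=> FF H U [/= _ [[V /= oV <-] Vx]] /filterS; apply.
have FV : (fun z : A1an v => (sn z : {ptws {poly k} -> R})) @ F -->
    (sn x : {ptws {poly k} -> R}).
  by apply/ptws_cvgP => P; exact: H.
by apply: FV; exact: open_nbhs_nbhs.
Qed.

Lemma A1an_cvg_map (T : Type) (F : set_system T) (h : T -> A1an v) x :
  Filter F -> (forall P, (fun t => h t P) @ F --> x P) -> h @ F --> x.
Proof. by move=> FF H; apply: A1an_cvg => P; exact: H. Qed.

Lemma thicken_continuous x : continuous (thicken x).
Proof. by move=> t; apply: A1an_cvg_map => P; exact: gauss_norm_continuous. Qed.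

Lemma eta_continuous P : continuous (fun t : R => eta t P).
Proof. exact: gauss_norm_continuous. Qed.

(** A disc is a closed subset of a product of segments indexed by the
    polynomials. *)
Lemma disc_compact M : compact [set x : A1an v | x 'X <= M].
Proof.
rewrite compact_ultra => F FU FM.
pose h := fun x : A1an v => (sn x : {ptws {poly k} -> R}).
pose K := [set u : {ptws {poly k} -> R} |
  forall P, `[0, eta M P]%classic (u P)].
have cpt : compact K.
  apply: (@tychonoff {poly k} (fun=> R) (fun P => `[0, eta M P]%classic)) => P.
  exact: segment_compact.
have FK : F (h @^-1` K).
  apply: filterS FM => x xM P; rewrite /= in_itv /=; apply/andP; split.
    exact: (sn_ge0 x P).
  exact: (ble_eta xM P).
have [l [_ hl]] : K `&` [set l | h @ F --> l] !=set0.
  by move: cpt; rewrite compact_ultra => /(_ (h @ F) (fmap_ultra h FU)); apply.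
have cvl P : (fun x : A1an v => x P) @ F --> l P.
  by move/ptws_cvgP : hl; exact.
have l0 P : 0 <= l P.
  by apply: (real_cvg_ge _ (cvl P)); apply: nearW => x; exact: sn_ge0.
have lC c : l c%:P = v c.
  apply: (real_cvg_unique _ (cvl _)).
  have -> : (fun x : A1an v => x c%:P) = fun=> v c.
    by apply/funext => x; rewrite snC.
  exact: cvg_cst.
have lM P Q : l (P * Q) = l P * l Q.
  apply: (real_cvg_unique _ (cvl _)).
  have -> : (fun x : A1an v => x (P * Q)) = (fun x : A1an v => x P * x Q).
    by apply/funext => x; rewrite snM.
  exact: cvgM.
have lD P Q : l (P + Q) <= l P + l Q.
  have c : (fun x : A1an v => x P + x Q - x (P + Q)) @ F -->
      l P + l Q - l (P + Q) by apply: cvgB; [exact: cvgD|].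
  rewrite -subr_ge0; apply: (real_cvg_ge _ c); apply: nearW => x.
  by rewrite subr_ge0; exact: snD.
exists (A1An l0 lC lM lD); split; last by apply: A1an_cvg => P; exact: cvl.
by rewrite /=; apply: (real_cvg_le _ (cvl 'X)); exact: FM.
Qed.

Lemma disc_closed M : closed [set x : A1an v | x 'X <= M].
Proof.
have -> : [set x : A1an v | x 'X <= M] =
  (fun x : A1an v => x 'X) @^-1` [set t | t <= M] by [].
by apply: preimage_closed; [move=> x _; exact: sn_continuous|exact: closed_le].
Qed.

Lemma compact_bounded_an (K : set (A1an v)) : compact K -> bounded_an K.
Proof.
move=> Kc; have : compact ((fun x : A1an v => x 'X) @` K).
  apply: continuous_compact => //; apply: continuous_subspaceT.
  exact: sn_continuous.
move=> /compact_bounded[M [_ HM]]; exists (M + 1) => x Kx.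
apply: le_trans (ler_norm _) _; apply: HM; [by rewrite ltrDl | by exists x].
Qed.

(** A sequence escapes to infinity when its absolute values do. *)
Lemma tends_to_inftyP (u : nat -> A1an v) : tends_to_infty u <->
  forall M : R, exists N, forall n, (N <= n)%N -> M < u n 'X.
Proof.
split=> [uoo M|H U [K [/compact_bounded_an[M KM] Kcl] KU]].
  have : nbhs (None : P1an v)
      (Some @` (~` [set x : A1an v | x 'X <= M]) `|` [set None]).
    by exists [set x : A1an v | x 'X <= M] => //; split;
      [exact: disc_compact|exact: disc_closed].
  move=> /uoo[N _ HN]; exists N => n /HN /= [[x xM [<-]]|//].
  by rewrite ltNge; apply/negP.
have [N HN] := H M; exists N => // n /HN Mn; apply: KU; left => /=.
by exists (u n) => // /KM; rewrite leNgt Mn.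
Qed.

End Points.
(** * Substitution in polynomials *)

Section Substitution.
Context (R : realType) (A : comNzRingType) (q : {poly A} -> R).
Hypothesis Q : mult_seminorm q.
Implicit Types (P a b : {poly A}).

Lemma ms_dist_le a b : `|q a - q b| <= q (a - b).
Proof.
have H c d : q c - q d <= q (c - d).
  rewrite lerBlDr -{1}(subrK d c); apply: le_trans (ms_D Q _ _) _.
  by apply: max_le_add; exact: ms_ge0 Q _.
by rewrite ler_norml H andbT lerNl opprB (ms_distC Q) H.
Qed.

(** Polynomials are Lipschitz on bounded sets. *)
Lemma comp_poly_lipschitz P M : 0 <= M -> exists C, 0 <= C /\
  forall a b, q a <= M -> q b <= M ->
    q (P \Po a) <= C /\ q ((P \Po a) - (P \Po b)) <= C * q (a - b).
Proof.
move=> M0; elim/poly_ind : P => [|P c [C [C0 HC]]].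
  exists 0; split=> // a b _ _.
  by rewrite !comp_poly0 subrr mul0r (ms_0 Q).
exists (C * M + C + q c%:P); split.
  by rewrite !addr_ge0 ?mulr_ge0 ?(ms_ge0 Q).
move=> a b aM bM; have [Pa Pab] := HC _ _ aM bM; rewrite !comp_poly_MXaddC.
have CM : q (P \Po a) * q a <= C * M by rewrite ler_pM ?(ms_ge0 Q).
split.
  apply: le_trans (ms_D Q _ _) _; rewrite (ms_M Q).
  have := ms_ge0 Q c%:P; have := mulr_ge0 C0 M0.
  by move=> *; rewrite ge_max; apply/andP; split; lra.
have -> : (P \Po a) * a + c%:P - ((P \Po b) * b + c%:P) =
  (P \Po a) * (a - b) + ((P \Po a) - (P \Po b)) * b by ring.
apply: le_trans (ms_D Q _ _) _; rewrite !(ms_M Q).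
have ab0 := ms_ge0 Q (a - b); have c0 := ms_ge0 Q c%:P.
have CMab0 : 0 <= C * M * q (a - b) by rewrite !mulr_ge0.
have Cab0 : 0 <= C * q (a - b) by rewrite mulr_ge0.
have cab0 : 0 <= q c%:P * q (a - b) by rewrite mulr_ge0.
rewrite !mulrDl ge_max; apply/andP; split.
  have : q (P \Po a) * q (a - b) <= C * q (a - b) by rewrite ler_wpM2r.
  lra.
have : q ((P \Po a) - (P \Po b)) * q b <= C * q (a - b) * M.
  by rewrite ler_pM // (ms_ge0 Q).
rewrite mulrAC; lra.
Qed.

Lemma comp_poly_cvg (a : nat -> {poly A}) b P :
  (fun n => q (a n - b)) @ \oo --> (0 : R) ->
  (fun n => q (P \Po a n)) @ \oo --> q (P \Po b).
Proof.
move=> ab; pose M := Num.max 1 (q b).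
have M0 : 0 <= M by rewrite le_max ler01.
have [C [C0 HC]] := comp_poly_lipschitz P M0.
apply/cvgrPdist_le => e e0.
have d0 : 0 < Num.min 1 (e / (C + 1)).
  by rewrite lt_min ltr01 divr_gt0 // ltr_wpDl.
move/cvgrPdist_le : ab => /(_ _ d0)[N _ HN]; exists N => // n /HN /=.
rewrite sub0r normrN ger0_norm ?(ms_ge0 Q) // le_min => /andP[ab1 abe].
have bM : q b <= M by rewrite le_max lexx orbT.
have aM : q (a n) <= M.
  rewrite -(subrK b (a n)); apply: le_trans (ms_D Q _ _) _.
  by rewrite ge_max bM andbT (le_trans ab1) // le_max lexx.
have [_ H] := HC _ _ aM bM.
rewrite distrC; apply: le_trans (ms_dist_le _ _) _; apply: le_trans H _.
apply: (@le_trans _ _ ((C + 1) * q (a n - b))).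
  by rewrite ler_wpM2r ?(ms_ge0 Q) // lerDl.
by rewrite mulrC -ler_pdivlMr // ltr_wpDl.
Qed.

End Substitution.

(** * Entire maps *)

Section Entire.
Context (R : realType) (k : fieldType) (v : nonarch_absval R k).
Context (f : A1an v -> A1an v) (c : nat -> k).
Hypotheses (c_cvg : everywhere_convergent v c) (f_series : given_by_series f c).
Hypothesis c_inf : forall N : nat, exists2 n : nat, (N <= n)%N & c n != 0.
Implicit Types (x y z : A1an v) (P : {poly k}) (r s t : R).

Let V := absv_mult_seminorm v.
Local Notation F n := (\poly_(i < n) c i).
Local Notation term r i := (v (c i) * r ^+ i).

Lemma absv_gt0 (a : k) : a != 0 -> 0 < v a.
Proof.
by move=> a0; rewrite lt0r absv_ge0 andbT; apply: contra a0 => /eqP/absv_eq0->.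
Qed.

Lemma f_monotone x y : ble x y -> ble (f x) (f y).
Proof.
move=> xy P; rewrite -subr_ge0.
have h : (fun n => y (P \Po F n) - x (P \Po F n)) @ \oo --> f y P - f x P.
  by apply: cvgB; exact: f_series.
by apply: (real_cvg_ge _ h); apply: nearW => n; rewrite subr_ge0.
Qed.

Lemma term_small r e : 0 <= r -> 0 < e ->
  exists N, forall n, (N <= n)%N -> term r n <= e.
Proof.
move=> r0 e0; have /cvgrPdist_le /(_ e e0) [N _ HN] := c_cvg r0.
exists N => n /HN /=; rewrite sub0r normrN ger0_norm //.
by rewrite mulr_ge0 ?absv_ge0 ?exprn_ge0.
Qed.

(** The value of [T] at the image of the Gauss point of radius [r]; it is the
    maximum of the [|c_i| r ^ i]. *)
Definition mu r : R := f (eta v r) 'X.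

Lemma mu_cvg r : (fun n => eta v r (F n)) @ \oo --> mu r.
Proof.
have := @f_series (eta v r) 'X; apply: cvg_trans; apply: near_eq_cvg.
by apply: nearW => n; rewrite comp_polyX.
Qed.

Lemma mu_ge0 r : 0 <= mu r. Proof. exact: sn_ge0. Qed.

Lemma mu_coef r i : 0 <= r -> term r i <= mu r.
Proof.
move=> r0; apply: (real_cvg_ge _ (@mu_cvg r)); exists i.+1 => // n /= ltn.
by have := eta_coef v (F n) i r0; rewrite coef_poly ltn.
Qed.

Lemma mu_le r M : 0 <= r -> 0 <= M -> (forall i, term r i <= M) -> mu r <= M.
Proof.
move=> r0 M0 H; apply: (real_cvg_le _ (@mu_cvg r)); apply: nearW => n.
apply: eta_le => // i; rewrite coef_poly; case: ifP => // _.
by rewrite (ms_0 V) mul0r.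
Qed.

Lemma mu_homo r s : 0 <= r -> r <= s -> mu r <= mu s.
Proof.
move=> r0 rs; have s0 := le_trans r0 rs.
apply: mu_le => //; first exact: mu_ge0.
move=> i; apply: le_trans (mu_coef i s0).
by rewrite ler_wpM2l ?absv_ge0 // lerXn2r.
Qed.

Lemma f_le_mu x r : x 'X <= r -> f x 'X <= mu r.
Proof. by move=> xr; apply: (f_monotone (ble_eta xr)). Qed.

Lemma mu_trunc r N : 0 <= r ->
  (forall n, (N <= n)%N -> term r n <= eta v r (F N)) -> mu r = eta v r (F N).
Proof.
move=> r0 H; apply/eqP; rewrite eq_le; apply/andP; split.
  apply: mu_le => //; first exact: sn_ge0.
  move=> i; have [iN|/H//] := ltnP i N.
  by have := eta_coef v (F N) i r0; rewrite coef_poly iN.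
apply: eta_le => //; first exact: mu_ge0.
move=> i; rewrite coef_poly; case: ifP => _; first exact: mu_coef.
by rewrite (ms_0 V) mul0r mu_ge0.
Qed.

(** On bounded intervals away from [0], [mu] is given by a truncation. *)
Lemma mu_trunc_uniform a b : 0 < a -> a <= b -> exists N,
  forall r, a <= r -> r <= b -> mu r = eta v r (F N).
Proof.
move=> a0 ab; have [i _ ci] := c_inf 0.
have e0 : 0 < term a i by rewrite mulr_gt0 ?absv_gt0 ?exprn_gt0.
have [N HN] := term_small (le_trans (ltW a0) ab) e0.
exists (maxn N i.+1) => r ar rb; have r0 := le_trans (ltW a0) ar.
apply: mu_trunc => // n; rewrite geq_max => /andP[Nn _].
apply: (@le_trans _ _ (term b n)).
  by rewrite ler_wpM2l ?absv_ge0 // lerXn2r ?nnegrE // (le_trans r0).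
apply: le_trans (HN _ Nn) _; apply: (@le_trans _ _ (term r i)).
  by rewrite ler_wpM2l ?absv_ge0 // lerXn2r ?nnegrE // ltW.
have := eta_coef v (F (maxn N i.+1)) i r0.
by rewrite coef_poly leq_max ltnSn orbT.
Qed.

Lemma mu_gt0 r : 0 < r -> 0 < mu r.
Proof.
move=> r0; have [i _ ci] := c_inf 0; apply: lt_le_trans (mu_coef i (ltW r0)).
by rewrite mulr_gt0 ?absv_gt0 ?exprn_gt0.
Qed.

Lemma mu_last r : 0 < r -> exists i, term r i = mu r /\
  forall j, (i < j)%N -> term r j < mu r.
Proof.
move=> r0; have m0 := mu_gt0 r0.
have [N1 H1] := mu_trunc_uniform r0 (lexx r).
have [N2 H2] := term_small (ltW r0) (divr_gt0 m0 (ltr0n _ 2)).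
have {}H2 n : (N2 <= n)%N -> term r n < mu r.
  by move=> /H2 h; apply: le_lt_trans h _; lra.
pose N := maxn N1 N2.
have EN : mu r = eta v r (F N).
  apply: mu_trunc; first exact: ltW.
  move=> n; rewrite geq_max => /andP[_ /H2/ltW h]; apply: le_trans h _.
  rewrite (H1 r) //; apply: eta_le; rewrite ?sn_ge0 ?(ltW r0) // => i.
  rewrite coef_poly; case: ifP => iN1; last by rewrite (ms_0 V) mul0r sn_ge0.
  have := eta_coef v (F N) i (ltW r0).
  by rewrite coef_poly (leq_trans iN1) // leq_maxl.
have g0 : 0 < gauss v r (F N) by rewrite -(etaE _ _ (ltW r0)) -EN.
have [i [Ei Hi]] := exists_last_dominant V (ltW r0) g0.
have iN : (i < N)%N.
  rewrite ltnNge; apply/negP => Ni; move: g0; rewrite -Ei coef_poly.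
  by rewrite ltnNge Ni (ms_0 V) mul0r ltxx.
move: Ei; rewrite coef_poly iN -(etaE _ _ (ltW r0)) -EN => Ei.
exists i; split=> // j /Hi; rewrite coef_poly -(etaE _ _ (ltW r0)) -EN.
case: ltnP => // Nj _; apply: H2; apply: leq_trans Nj; exact: leq_maxr.
Qed.

(** Beyond some radius discs are expanded and swallow [f(0)]. *)
Definition expanding (R0 : R) := 1 <= R0 /\
  forall r, R0 <= r -> v (c 0) < mu r /\ 2 * r <= mu r.

Lemma exists_expanding : exists R0, expanding R0.
Proof.
have [i i2 ci] := c_inf 2; have a0 := absv_gt0 ci; set a := v (c i) in a0.
exists (1 + (2 + v (c 0)) / a); have w0 := absv_ge0 v (c 0); split.
  by rewrite lerDl divr_ge0 ?ltW // ltr_wpDr.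
move=> r Hr; have r1 : 1 <= r.
  by apply: le_trans Hr; rewrite lerDl divr_ge0 ?ltW // ltr_wpDr.
have ar : 2 + v (c 0) <= a * r.
  by rewrite mulrC -ler_pdivrMr //; apply: le_trans Hr; rewrite lerDr.
have r2 : a * r * r <= mu r.
  apply: le_trans (mu_coef i (le_trans ler01 r1)).
  by rewrite -mulrA ler_pM2l // -expr2 ler_weXn2l.
have : (2 + v (c 0)) * r <= mu r.
  by apply: le_trans r2; rewrite ler_wpM2r // (le_trans ler01).
have : v (c 0) <= v (c 0) * r by rewrite ler_peMr.
by rewrite mulrDl => *; split; lra.
Qed.

(** A radius is critical if [f] has two dominant terms there. *)
Definition critical r := exists i j,
  [/\ (i < j)%N, term r i = mu r & term r j = mu r].

(** Preimages under [f], as zeros of the series [f(T) - S] over the polynomial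
    ring in [S] normed by the given point. *)
Lemma exists_preimage y r D i j
  (g := fun n => (c n)%:P - (if n == 0%N then 'X else 0) : {poly k}) :
  0 < r -> 0 < D -> (i < j)%N ->
  y (g i) * r ^+ i = D -> y (g j) * r ^+ j = D ->
  (forall n, y (g n) * r ^+ n <= D) ->
  exists z, z 'X = r /\ f z = y.
Proof.
move=> r0 D0 ij Ei Ej gD; have Y := sn_mult_seminorm y.
have gS n : (0 < n)%N -> g n = (c n)%:P by case: n => // n _; rewrite /g subr0.
have g_cvg e : 0 < e -> exists N, forall n, (N <= n)%N -> y (g n) * r ^+ n <= e.
  move=> /(term_small (ltW r0))[N HN]; exists N.+1 => n Nn.
  by rewrite gS ?snC ?HN // ?(ltnW Nn) // (leq_trans _ Nn).
have [|||q [Q _ qC qX qG]] := exists_zero Y r0 g_cvg ij.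
- by rewrite Ei.
- by rewrite Ei.
- by move=> n; rewrite Ei.
pose em := map_poly (@polyC k).
have Qz : mult_seminorm (fun P => q (em P)).
  split=> [P|||P P'|P P']; rewrite /em ?rmorph0 ?rmorph1 ?rmorphM ?rmorphD.
  - exact: ms_ge0 Q _.
  - exact: ms_0 Q.
  - exact: ms_1 Q.
  - exact: ms_M Q _ _.
  - exact: ms_D Q _ _.
have zC a : q (em a%:P) = v a by rewrite /em map_polyC qC snC.
exists (mk_point Qz zC); split; first by rewrite /= /em map_polyX.
apply: A1an_eq => P; apply: real_cvg_unique (@f_series _ P) _.
have -> : y P = q (em P \Po 'X%:P).
  rewrite comp_polyCr -[em P]/(map_poly polyC P) -[(_).['X]]/(P \Po 'X).
  by rewrite comp_polyXr qC.
have -> : (fun n => mk_point Qz zC (P \Po F n)) =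
    (fun n => q (em P \Po em (F n))).
  by apply/funext => n; rewrite /= /em map_comp_poly.
apply: comp_poly_cvg => //; move: qG; apply: cvg_trans; apply: near_eq_cvg.
exists 1%N => // n /= n0; congr (q _); apply/polyP => m.
rewrite coefB coef_map coefC !coef_poly /= /g.
case: ifP => mn; first by case: eqP => // _; rewrite subr0.
by case: m mn => [|m _]; [rewrite n0|rewrite rmorph0 subrr].
Qed.

(** A fixed point on a critical circle, as a zero of the series [f(T) - T]. *)
Lemma exists_fixed_point R0 r : expanding R0 -> R0 <= r -> critical r ->
  exists p : A1an v, p 'X = r /\ f p = p.
Proof.
move=> [R01 HR] Rr [i [j [ij Ei Ej]]].
have r1 : 1 <= r := le_trans R01 Rr; have r0 : 0 < r := lt_le_trans ltr01 r1.
have [_ m2] := HR _ Rr; have rm : r < mu r by lra.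
pose d n : k := if n == 1%N then 1 else 0.
pose g n := c n - d n.
have dr n : v (d n) * r ^+ n <= r.
  rewrite /d; case: eqP => [->|_]; first by rewrite (ms_1 V) mul1r.
  by rewrite (ms_0 V) mul0r ltW.
have gE n : term r n = mu r -> v (g n) * r ^+ n = mu r.
  move=> En; rewrite -En (ms_dominantB V) //.
  by rewrite -(ltr_pM2r (exprn_gt0 n r0)) En (le_lt_trans (dr n)).
have g_le n : v (g n) * r ^+ n <= mu r.
  apply: le_trans (_ : Num.max (v (c n)) (v (d n)) * r ^+ n <= _).
    by rewrite ler_wpM2r ?(ms_B V) // exprn_ge0 // ltW.
  rewrite maxr_pMl ?exprn_ge0 ?(ltW r0) // ge_max mu_coef ?(ltW r0) //=.
  by apply: le_trans (dr n) _; exact: ltW.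
have g_cvg e : 0 < e -> exists N, forall n, (N <= n)%N -> v (g n) * r ^+ n <= e.
  move=> /(term_small (ltW r0))[N HN]; exists (maxn N 2) => n.
  rewrite geq_max => /andP[Nn n2]; rewrite /g /d.
  by case: eqP n2 => [->//|_ _]; rewrite subr0 HN.
have [|||q [Q _ qC qX qG]] := exists_zero V r0 g_cvg ij.
- by rewrite gE // mu_gt0.
- by rewrite !gE.
- by move=> n; rewrite (gE i).
exists (mk_point Q qC); split=> //.
apply: A1an_eq => P; apply: real_cvg_unique (@f_series _ P) _ => /=.
rewrite -{2}[P]comp_polyXr; apply: comp_poly_cvg => //.
move: qG; apply: cvg_trans; apply: near_eq_cvg.
exists 2%N => // n /= n2; congr (q _); apply/polyP => m.
rewrite coefB coefX !coef_poly /g /d.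
case: ifP => mn; first by case: eqP.
by case: eqP mn => [->|_ _]; [rewrite n2|rewrite subrr].
Qed.

Lemma critical_unbounded t : exists r, t < r /\ critical r.
Proof.
pose t0 := Num.max 1 (t + 1).
have t1 : 1 <= t0 by rewrite le_max lexx.
have tt0 : t < t0 by rewrite lt_max ltrDl ltr01 orbT.
have t00 : 0 < t0 := lt_le_trans ltr01 t1.
have [i [Ei Hi]] := mu_last t00; have [j ij cj] := c_inf i.+1.
have m0 := mu_gt0 t00; have wj := absv_gt0 cj.
have wi : 0 < v (c i).
  by rewrite -(pmulr_lgt0 _ (exprn_gt0 i t00)) Ei.
(* beyond [r1] the term of index [j] exceeds that of index [i] *)
pose r1 := Num.max t0 (v (c i) / v (c j)).
have r1t : t0 <= r1 by rewrite le_max lexx.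
have r10 : 0 < r1 := lt_le_trans t00 r1t.
have ijr1 : term r1 i <= term r1 j.
  have -> : r1 ^+ j = r1 ^+ (j - i) * r1 ^+ i.
    by rewrite -exprD subnK // ltnW.
  rewrite mulrA ler_wpM2r ?exprn_ge0 ?(ltW r10) //.
  rewrite mulrC -ler_pdivrMr //; apply: (@le_trans _ _ r1).
    by rewrite le_max lexx orbT.
  by rewrite -[leLHS]expr1 ler_weXn2l ?(le_trans t1) // subn_gt0.
have [N HN] := term_small (ltW r10) m0.
pose n := maxn N j.+1.
pose B := \poly_(l < n) (if (i < l)%N then c l else 0).
pose h s := eta v s B - v (c i) * s ^+ i.
have hc : continuous h.
  move=> s; apply: cvgB; first exact: eta_continuous.
  by apply: cvgM; [exact: cvg_cst|exact: exprn_continuous].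
have ht0 : h t0 < 0.
  rewrite subr_lt0 etaE ?(ltW t00) // Ei; apply: gauss_lt => // l.
  rewrite coef_poly; case: ifP => _; last by rewrite (ms_0 V) mul0r.
  by case: ifP => [/Hi//|_]; rewrite (ms_0 V) mul0r.
have hr1 : 0 <= h r1.
  rewrite subr_ge0; apply: le_trans ijr1 _.
  have := eta_coef v B j (ltW r10).
  by rewrite coef_poly leq_max ltnSn orbT ij.
have [s] : exists2 s, s \in `[t0, r1] & h s = 0.
  apply: IVT => //; first exact: continuous_subspaceT.
  by rewrite ge_min le_max (ltW ht0) hr1 orbT.
rewrite in_itv /= => /andP[ts sr] /eqP; rewrite subr_eq0 => /eqP Es.
have s0 : 0 < s := lt_le_trans t00 ts.
have ws : 0 < term s i by rewrite mulr_gt0 ?exprn_gt0.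
have m_le : term t0 i <= term s i.
  by rewrite ler_pM2l // lerXn2r ?nnegrE // ltW.
have ms : mu s = term s i.
  apply/eqP; rewrite eq_le mu_coef ?(ltW s0) // andbT.
  apply: mu_le; rewrite ?(ltW s0) ?(ltW ws) // => l.
  have [il|li] := ltnP i l; last first.
    (* the terms of index below [i] grow slower than that of index [i] *)
    have Hl := mu_coef l (ltW t00); rewrite -Ei in Hl.
    have e (w : R) : w ^+ i = w ^+ (i - l) * w ^+ l by rewrite -exprD subnK.
    rewrite -(ler_pM2r (exprn_gt0 i t00)).
    rewrite [leRHS](_ : _ = term t0 i * (s ^+ (i - l) * s ^+ l)); last first.
      by rewrite -e; ring.
    rewrite [leLHS](_ : _ = term t0 l * (t0 ^+ (i - l) * s ^+ l)); last first.
      by rewrite (e t0); ring.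
    rewrite ler_pM // ?mulr_ge0 ?exprn_ge0 ?absv_ge0 ?(ltW t00) ?(ltW s0) //.
    rewrite ler_wpM2r ?exprn_ge0 ?(ltW s0) //.
    by rewrite lerXn2r ?nnegrE ?(ltW t00) ?(ltW s0).
  have [ln|nl] := ltnP l n.
    by rewrite -Es; have := eta_coef v B l (ltW s0); rewrite coef_poly ln il.
  apply: (@le_trans _ _ (term r1 l)).
    by rewrite ler_wpM2l ?absv_ge0 // lerXn2r ?nnegrE ?(ltW r10) ?(ltW s0).
  apply: le_trans (_ : mu t0 <= _); last by rewrite -Ei.
  by apply: HN; apply: leq_trans nl; exact: leq_maxl.
exists s; split; first exact: lt_le_trans ts.
have B0 : 0 < gauss v s B by rewrite -etaE ?(ltW s0) // Es.
have [l] := gauss_dominant V (ltW s0) B0.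
rewrite -etaE ?(ltW s0) // Es coef_poly.
case: ifP => _; last by rewrite (ms_0 V) mul0r => E; rewrite -E ltxx in ws.
case: ifP => [il El|_]; last first.
  by rewrite (ms_0 V) mul0r => E; rewrite -E ltxx in ws.
by exists i, l; rewrite ms.
Qed.

Section Expanding.
Variables (R0 : R) (HR : expanding R0).

Lemma R0_gt0 r : R0 <= r -> 0 < r.
Proof. by apply: lt_le_trans; case: HR => + _; apply: lt_le_trans. Qed.

Lemma mu_ge2 r : R0 <= r -> 2 * r <= mu r.
Proof. by case: HR => _ H /H[]. Qed.

Lemma mu_gt r : R0 <= r -> r < mu r.
Proof. by move=> Rr; have := mu_ge2 Rr; have := R0_gt0 Rr; lra. Qed.

Lemma c0_lt_mu r : R0 <= r -> v (c 0) < mu r.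
Proof. by case: HR => _ H /H[]. Qed.

Lemma iter_mu_ge n r : R0 <= r -> r + n%:R <= iter n mu r.
Proof.
move=> Rr; elim: n => [|n IH]; first by rewrite addr0.
have Rn : R0 <= iter n mu r.
  by apply: le_trans Rr _; apply: le_trans IH; rewrite lerDl.
rewrite iterS -natr1; have := mu_ge2 Rn.
have := proj1 HR; lra.
Qed.

Lemma iter_mu_R0 n r : R0 <= r -> R0 <= iter n mu r.
Proof.
move=> Rr; apply: le_trans Rr (le_trans _ (iter_mu_ge n Rr)).
by rewrite lerDl.
Qed.

(** Every point inside the image of a critical disc has a preimage on the
    bounding circle. *)
Lemma preimage_critical y r : R0 <= r -> critical r -> y 'X < mu r ->
  exists z, z 'X = r /\ f z = y.
Proof.
move=> Rr [i [j [ij Ei Ej]]] yr; have r0 := R0_gt0 Rr; have m0 := mu_gt0 r0.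
have c0 := c0_lt_mu Rr.
have i0 : (0 < i)%N.
  by case: (i) Ei => // E; rewrite -E expr0 mulr1 ltxx in c0.
apply: (@exists_preimage y r (mu r) i j r0 m0 ij).
- by rewrite gtn_eqF // subr0 snC.
- by rewrite gtn_eqF ?(ltn_trans i0) // subr0 snC.
- move=> [|n] /=; last by rewrite subr0 snC mu_coef ?ltW.
  rewrite expr0 mulr1; apply: le_trans (ms_B (sn_mult_seminorm y) _ _) _.
  by rewrite snC ge_max !ltW.
Qed.

(** Points on the bounding circle of the image of a disc have a preimage on the
    circle bounding the disc. *)
Lemma preimage_circle y r : R0 <= r -> y 'X = mu r ->
  exists z, z 'X = r /\ f z = y.
Proof.
move=> Rr yr; have r0 := R0_gt0 Rr; have m0 := mu_gt0 r0.
have c0 := c0_lt_mu Rr; have Y := sn_mult_seminorm y.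
have [j [Ej _]] := mu_last r0.
have j0 : (0 < j)%N.
  by case: (j) Ej => // E; rewrite -E expr0 mulr1 ltxx in c0.
have E0 : y ((c 0)%:P - 'X) = mu r.
  by rewrite (ms_distC Y) (ms_dominantB Y) // snC yr.
apply: (@exists_preimage y r (mu r) 0 j r0 m0 j0).
- by rewrite /= expr0 mulr1.
- by rewrite gtn_eqF // subr0 snC.
- move=> [|n] /=; last by rewrite subr0 snC mu_coef ?ltW.
  by rewrite expr0 mulr1 E0.
Qed.

Lemma f_eta r : R0 <= r -> f (eta v r) = eta v (mu r).
Proof.
move=> Rr; have r0 := R0_gt0 Rr; have m0 := mu_gt0 r0.
apply: ble_anti; first exact: ble_eta.
have [|z [zr <-]] := @preimage_circle (eta v (mu r)) r Rr.
  by rewrite etaX // ltW.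
by apply: f_monotone; apply: ble_eta; rewrite zr.
Qed.

Lemma iter_f_eta n r : R0 <= r -> iter n f (eta v r) = eta v (iter n mu r).
Proof.
move=> Rr; elim: n => [//|n IH]; rewrite !iterS IH f_eta //.
exact: iter_mu_R0.
Qed.

Lemma eta_tends_to_infty r : R0 <= r ->
  tends_to_infty (fun n => iter n f (eta v r)).
Proof.
move=> Rr; apply/tends_to_inftyP => M.
exists (Num.bound M) => n Mn; rewrite iter_f_eta // etaX; last first.
  exact/ltW/R0_gt0/iter_mu_R0.
apply: lt_le_trans (iter_mu_ge n Rr); rewrite ltr_wpDl ?ltW ?R0_gt0 //.
apply: le_lt_trans (ler_norm _) _; apply: lt_le_trans (archi_boundP _) _ => //.
by rewrite ler_nat; apply: leq_trans Mn; rewrite /Num.bound normr_id.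
Qed.

Lemma eta_orbit_increasing r n : R0 <= r ->
  blt (iter n f (eta v r)) (iter n.+1 f (eta v r)).
Proof.
move=> Rr; rewrite !iter_f_eta //=; apply: blt_eta.
by rewrite etaX ?mu_gt ?iter_mu_R0 // ltW // R0_gt0 // iter_mu_R0.
Qed.

(** Intermediate values of the iterates of [mu]. *)
Lemma iter_mu_ivt n a b t : R0 <= a -> a <= b ->
  iter n mu a <= t -> t <= iter n mu b ->
  exists s, [/\ a <= s, s <= b & iter n mu s = t].
Proof.
move=> Ra ab; elim: n t => [|n IH] t; first by exists t.
rewrite !iterS => at_ tb; pose a' := iter n mu a; pose b' := iter n mu b.
have Ra' : R0 <= a' := iter_mu_R0 n Ra.
have ab' : a' <= b'.
  rewrite /a' /b'; elim: (n) => [//|m IHm] /=; apply: mu_homo IHm.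
  exact/ltW/R0_gt0/iter_mu_R0.
have [N EN] := mu_trunc_uniform (R0_gt0 Ra') ab'.
have [u] : exists2 u, u \in `[a', b'] & eta v u (F N) = t.
  apply: IVT => //; first by apply: continuous_subspaceT; exact: eta_continuous.
  by rewrite -!EN // ge_min le_max at_ tb orbT.
rewrite in_itv /= => /andP[au ub] Et.
have [s [as_ sb Es]] := IH u au ub.
by exists s; split=> //=; rewrite Es EN.
Qed.

(** The critical radii pull back into any fundamental interval of [mu]. *)
Lemma critical_orbits r N : R0 <= r -> exists n s,
  [/\ (N <= n)%N, r <= s, s <= mu r & critical (iter n mu s)].
Proof.
move=> Rr; have [t [Nt Ct]] := critical_unbounded (iter N mu r).
have ex : exists m, t < iter m mu r.
  exists (Num.bound t); apply: lt_le_trans (iter_mu_ge _ Rr).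
  rewrite ltr_wpDl ?ltW ?R0_gt0 //; apply: archi_boundP.
  by apply: ltW; apply: lt_trans Nt; apply/R0_gt0/iter_mu_R0.
case: (ex_minnP ex) => m tm minm.
have homo a b : (a <= b)%N -> iter a mu r <= iter b mu r.
  move=> /subnK <-; elim: (b - a)%N => [//|l IHl]; rewrite addSn iterS.
  by apply: le_trans IHl _; apply/ltW/mu_gt/iter_mu_R0.
have Nm : (N < m)%N.
  rewrite ltnNge; apply/negP => /homo mN.
  by have := lt_trans (lt_le_trans tm mN) Nt; rewrite ltxx.
case: m Nm tm minm => // m Nm tm minm.
have mt : iter m mu r <= t.
  by rewrite leNgt; apply/negP => /minm; rewrite ltnn.
have tm' : t <= iter m mu (mu r) by rewrite -iterSr ltW.
have [s [rs sm Es]] := iter_mu_ivt Rr (ltW (mu_gt Rr)) mt tm'.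
by exists m, s; split=> //; rewrite Es.
Qed.

End Expanding.

End Entire.
(** * Convergence to Gauss points *)

Section ConvergenceToGauss.
Context (R : realType) (k : fieldType) (v : nonarch_absval R k).
Implicit Types (x y z : A1an v) (P a b p : {poly k}) (r t : R).

(** A polynomial with a single dominant term on a circle has constant absolute
    value there. *)
Lemma sn_single_dominant z P l :
  (forall i, i <> l -> v P`_i * z 'X ^+ i < v P`_l * z 'X ^+ l) ->
  z P = v P`_l * z 'X ^+ l.
Proof.
move=> H; have Z := sn_mult_seminorm z.
have D0 : 0 < v P`_l * z 'X ^+ l.
  apply: le_lt_trans (H l.+1 _); last by move=> /eqP; rewrite gtn_eqF.
  by rewrite mulr_ge0 ?absv_ge0 ?exprn_ge0 ?sn_ge0.
have lP : (l < size P)%N.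
  rewrite ltnNge; apply/negP => Pl; move: D0; rewrite nth_default //.
  by rewrite (ms_0 (absv_mult_seminorm v)) mul0r ltxx.
have T i : z (P`_i *: 'X^i) = v P`_i * z 'X ^+ i.
  by rewrite -mul_polyC snM snC snXn.
rewrite -{1}[P]coefK poly_def (bigD1 (Ordinal lP)) //= ms_dominant ?T //.
apply: ms_sum_lt => // i il; rewrite T; apply: H => E.
by move/eqP: il; apply; exact: val_inj.
Qed.

Lemma eta_sn_single_dominant z P l :
  (forall i, i <> l -> v P`_i * z 'X ^+ i < v P`_l * z 'X ^+ l) ->
  z P = eta v (z 'X) P.
Proof.
move=> H; rewrite (sn_single_dominant H).
rewrite (@sn_single_dominant (eta v (z 'X)) _ l).
  by rewrite etaX // sn_ge0.
by rewrite etaX // sn_ge0.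
Qed.

(** Near a circle, but off it, points are not told apart from Gauss points by a
    given polynomial. *)
Lemma eta_sn_punctured P r : 0 < r ->
  \forall t \near r, forall z, z 'X = t -> t <> r -> z P = eta v t P.
Proof.
move=> r0; have [->|P0] := eqVneq P 0.
  by near=> t => z _ _; rewrite !(ms_0 (sn_mult_seminorm _)).
have V := absv_mult_seminorm v; have r_ge0 := ltW r0.
have g0 : 0 < gauss v r P by rewrite -etaE // eta_gt0.
have [l [El Hl]] := exists_last_dominant V r_ge0 g0.
have [m [Em Hm]] := exists_first_dominant V r_ge0 g0.
have small (C : pred nat) d : v P`_d * r ^+ d = gauss v r P ->
    (forall i, C i -> v P`_i * r ^+ i < gauss v r P) ->
    \forall t \near r, 0 < t ->
      forall i, C i -> v P`_i * t ^+ i < v P`_d * t ^+ d.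
  move=> Ed HC; pose B := \poly_(i < size P) (if C i then P`_i else 0).
  pose h t := v P`_d * t ^+ d - eta v t B.
  have hc : h @ r --> h r.
    apply: cvgB; last exact: eta_continuous.
    by apply: cvgM; [exact: cvg_cst|exact: exprn_continuous].
  have hr : 0 < h r.
    rewrite subr_gt0 Ed etaE //; apply: gauss_lt => // i.
    rewrite coef_poly; case: ifP => _; last by rewrite (ms_0 V) mul0r.
    by case: ifP => [/HC//|_]; rewrite (ms_0 V) mul0r.
  have hn : \forall t \near r, 0 < h t by exact: cvgr_gt hc _ hr.
  move: hn; apply: filterS => t; rewrite subr_gt0 => ht t0 i Ci.
  apply: le_lt_trans ht; have := eta_coef v B i (ltW t0).
  rewrite coef_poly Ci; case: ltnP => // /(nth_default 0) -> _.
  by rewrite (ms_0 V) mul0r sn_ge0.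
have pos : \forall t \near r, 0 < t.
  by apply: (@cvgr_gt R R (nbhs r) _ id r _ 0 r0); exact: cvg_id.
have Sl := small (fun i => (l < i)%N) l El Hl.
have Sm := small (fun i => (i < m)%N) m Em Hm.
have wl : 0 < v P`_l by rewrite -(pmulr_lgt0 _ (exprn_gt0 l r0)) El.
have wm : 0 < v P`_m by rewrite -(pmulr_lgt0 _ (exprn_gt0 m r0)) Em.
apply: filterS3 pos Sl Sm => t t0 Stl Stm z zt tr.
have {}Stl := Stl t0; have {}Stm := Stm t0.
rewrite -zt; have [tlt|rlt|//] := ltgtP t r; last first.
(* a radius larger than [r]: the last dominant term wins *)
- apply: (@eta_sn_single_dominant z P l) => i il; rewrite zt.
  have [//|li] := ltnP l i; first exact: Stl.
  have {il li} li : (i < l)%N by rewrite ltn_neqAle li andbT; apply/eqP.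
  have e (w : R) : w ^+ l = w ^+ (l - i) * w ^+ i.
    by rewrite -exprD subnK // ltnW.
  have Hi := gauss_coef V r_ge0 P i; rewrite -El in Hi.
  rewrite (e r) mulrA ler_pM2r ?exprn_gt0 // in Hi.
  rewrite (e t) mulrA ltr_pM2r ?exprn_gt0 //; apply: le_lt_trans Hi _.
  rewrite ltr_pM2l // ltrXn2r ?subn_eq0 -?ltnNge ?nnegrE ?ltW //.
- apply: (@eta_sn_single_dominant z P m) => i im; rewrite zt.
  have [//|li] := ltnP i m; first exact: Stm.
  have {im li} li : (m < i)%N.
    by rewrite ltn_neqAle li andbT; apply/eqP => E; apply: im.
  have e (w : R) : w ^+ i = w ^+ (i - m) * w ^+ m.
    by rewrite -exprD subnK // ltnW.
  have Hi := gauss_coef V r_ge0 P i; rewrite -Em in Hi.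
  rewrite (e r) mulrA ler_pM2r ?exprn_gt0 // in Hi.
  rewrite (e t) mulrA ltr_pM2r ?exprn_gt0 //.
  have [->|Pi] := eqVneq (v P`_i) 0; first by rewrite mul0r.
  apply: lt_le_trans Hi; rewrite ltr_pM2l ?lt0r ?Pi ?absv_ge0 //.
  by rewrite ltrXn2r ?subn_eq0 -?ltnNge ?nnegrE ?ltW.
Unshelve. all: by end_near. Qed.

Lemma cvg_eta_punctured r (z : nat -> A1an v) : 0 < r ->
  (fun n => z n 'X) @ \oo --> r -> (forall n, z n 'X <> r) ->
  z @ \oo --> eta v r.
Proof.
move=> r0 zr zN; apply: A1an_cvg_map => P.
have : (fun n => eta v (z n 'X) P) @ \oo --> eta v r P.
  by apply: (cvg_comp _ (fun t => eta v t P) zr); exact: eta_continuous.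
apply: cvg_trans; apply: near_eq_cvg.
have [N _ HN] := zr _ (eta_sn_punctured P r0).
by exists N => // n /HN H; rewrite (H (z n)).
Qed.

Section Separation.
Variables (y : A1an v) (z : nat -> A1an v) (C : nat -> Prop).
Hypotheses (y_gt0 : forall P, P != 0 -> 0 < y P)
  (zy : forall n, C n -> ble (z n) y)
  (sep : forall i j, C i -> C j -> (i < j)%N ->
     exists a, z i a < y a /\ z j a = y a).

Let Z n : mult_seminorm (z n). Proof. exact: sn_mult_seminorm. Qed.
Let Y : mult_seminorm y. Proof. exact: sn_mult_seminorm. Qed.

Lemma sep_eq n a : C n -> ~ (z n a < y a) -> z n a = y a.
Proof. by move=> Cn /negP; rewrite -leNgt => ya; apply/le_anti; rewrite zy. Qed.

Lemma sep_neq0 n a : z n a < y a -> a != 0.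
Proof.
by apply: contraTneq => ->; rewrite !(ms_0 (sn_mult_seminorm _)) ltxx.
Qed.

Lemma sep_mul n a b : C n -> z n a < y a -> b != 0 -> z n (b * a) < y (b * a).
Proof.
move=> Cn za b0; rewrite !snM.
apply: (@le_lt_trans _ _ (y b * z n a)); first by rewrite ler_wpM2r ?sn_ge0 ?zy.
by rewrite ltr_pM2l // y_gt0.
Qed.

(** If [p] has minimal degree among the polynomials with [z i p < y p], then the
    remainder of [a] modulo [p] is negligible for [y] whenever [z i a < y a]. *)
Lemma sep_key i a p : C i -> z i p < y p ->
  (forall b, z i b < y b -> (size p <= size b)%N) -> z i a < y a ->
  y (a %% p) < y a /\ y (a %/ p * p) = y a.
Proof.
move=> Ci ip minp ia; have p0 := sep_neq0 ip.
have aE := divp_eq a p; set q := a %/ p in aE *; set b := a %% p in aE *.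
have zb : z i b = y b.
  by apply: sep_eq => // /minp; rewrite leqNgt ltn_modp p0.
have ba : y b < y a.
  rewrite ltNge; apply/negP => ab.
  have [q0|q0] := eqVneq q 0.
    by move: ia; rewrite aE q0 mul0r add0r zb ltxx.
  have qp : y (q * p) <= y b.
    have -> : q * p = a - b by rewrite aE addrK.
    by apply: le_trans (ms_B Y _ _) _; rewrite ge_max ab lexx.
  have := sep_mul Ci ip q0 => zqp.
  have : z i b < y b.
    have {1}-> : b = a - q * p by rewrite {1}aE addrC addKr.
    apply: le_lt_trans (ms_B (Z i) _ _) _; rewrite gt_max.
    by rewrite (lt_le_trans ia ab) (lt_le_trans zqp qp).
  by rewrite zb ltxx.
split=> //; have -> : q * p = a - b by rewrite aE addrK.
by rewrite (ms_dominantB Y).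
Qed.

(** By [sep] the points of the sequence lie in distinct directions from [y],
    only finitely many of which are detected by a given polynomial. The proof is
    by induction on the degree: if [z i] is detected by [P] and [p] is of minimal
    degree among the polynomials that detect [z i], then up to a negligible
    remainder [P] is a multiple of [p], and [p] detects no [z n] with [n > i]. *)
Lemma sep_eventually P : P != 0 ->
  exists N, forall n, (N <= n)%N -> C n -> z n P = y P.
Proof.
have [m] := ubnP (size P); elim: m P => // m IH P; rewrite ltnS => Pm P0.
have [[i [Ci iP]]|nex] := pselect (exists i, C i /\ z i P < y P); last first.
  by exists 0%N => n _ Cn; apply: sep_eq => // nP; apply: nex; exists n.
have ex : exists s, `[< exists2 p : {poly k}, size p = s & z i p < y p >].
  by exists (size P); apply/asboolP; exists P.
case: (ex_minnP ex) => s /asboolP[p ps ip] mins.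
have minp b : z i b < y b -> (size p <= size b)%N.
  by move=> ib; rewrite ps; apply: mins; apply/asboolP; exists b.
have [bP qpP] := sep_key Ci ip minp iP.
have PE := divp_eq P p; set q := P %/ p in PE qpP *; set b := P %% p in PE bP *.
have p0 := sep_neq0 ip.
have size_p : (1 < size p)%N.
  rewrite ltnNge; apply/negP => /size1_polyC pC; move: ip.
  by rewrite pC !snC ltxx.
have q0 : q != 0.
  by apply: contraTneq (y_gt0 P0) => q0; rewrite -qpP q0 mul0r (ms_0 Y) ltxx.
have sq : (size q < m)%N.
  apply: leq_trans Pm; rewrite size_divp //.
  have sP : (0 < size P)%N by rewrite size_poly_gt0.
  by rewrite ltn_subrL sP -subn1 subn_gt0 size_p.
have [N HN] := IH q sq q0.
exists (maxn N i.+1) => n; rewrite geq_max => /andP[Nn ni] Cn.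
(* otherwise [z n] would lie in the same direction as [z i] *)
have zp : z n p = y p.
  apply: sep_eq => // np; have [a [ia na]] := sep Ci Cn ni.
  have [ba qpa] := sep_key Ci ip minp ia.
  have a0 := sep_neq0 ia.
  have qa0 : a %/ p != 0.
    by apply: contraTneq (y_gt0 a0) => qa; rewrite -qpa qa mul0r (ms_0 Y) ltxx.
  have : z n a < y a.
    rewrite {1}(divp_eq a p); apply: le_lt_trans (ms_D (Z n) _ _) _.
    rewrite gt_max (le_lt_trans (zy Cn _) ba) andbT -qpa.
    exact: sep_mul.
  by rewrite na ltxx.
have zqp : z n (q * p) = y P by rewrite snM zp (HN n) // -snM qpP.
by rewrite {1}PE (ms_dominant (Z n)) zqp // (le_lt_trans (zy Cn _)).
Qed.

End Separation.

(** The index set [C] allows for a sequence that is meaningful at some indices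
    only; [e] enumerates such indices. *)
Lemma cvg_separated (y : A1an v) (z : nat -> A1an v) (C : nat -> Prop)
    (e : nat -> nat) :
  (forall P, P != 0 -> 0 < y P) -> (forall n, C n -> ble (z n) y) ->
  (forall i j, C i -> C j -> (i < j)%N ->
     exists a, z i a < y a /\ z j a = y a) ->
  (forall n, C (e n)) -> (forall n, (n <= e n)%N) ->
  (fun n => z (e n)) @ \oo --> y.
Proof.
move=> y0 zy sep Ce e_ge; apply: A1an_cvg_map => P.
suff : \forall n \near \oo, y P = z (e n) P.
  by move=> H; apply: cvg_trans (near_eq_cvg H) _; exact: cvg_cst.
have [->|P0] := eqVneq P 0.
  by apply: nearW => n; rewrite !(ms_0 (sn_mult_seminorm _)).
have [N HN] := sep_eventually y0 zy sep P0.
by exists N => // n /= Nn; rewrite HN // (leq_trans Nn).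
Qed.

End ConvergenceToGauss.
(** * Julia points among Gauss points *)

Lemma max_cst_continuous (R : realType) (e : R) :
  continuous (fun t : R => Num.max e t).
Proof.
move=> t; apply: (@continuous_max _ _ (fun=> e) (fun s : R => s)).
  exact: cvg_cst.
exact: cvg_id.
Qed.

Section Dynamics.
Context (R : realType) (k : fieldType) (v : nonarch_absval R k).
Context (f : A1an v -> A1an v) (c : nat -> k).
Hypotheses (c_cvg : everywhere_convergent v c) (f_series : given_by_series f c).
Hypothesis c_inf : forall N : nat, exists2 n : nat, (N <= n)%N & c n != 0.
Implicit Types (x y z p : A1an v) (P Q : {poly k}) (r s t : R).

Lemma ultra_max x P Q (e : R) : x (P - Q) <= e ->
  Num.max e (x P) = Num.max e (x Q).
Proof.
have X := sn_mult_seminorm x.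
have H P' Q' : x (P' - Q') <= e -> Num.max e (x P') <= Num.max e (x Q').
  move=> d; rewrite ge_max le_max lexx /= -(subrK Q' P').
  apply: le_trans (ms_D X _ _) _; rewrite ge_max !le_max d lexx orbT.
  by [].
by move=> d; apply/le_anti; rewrite !H // (ms_distC X).
Qed.

(** Up to an error [e], iterates are given on a disc by polynomials. *)
Lemma iter_approx n P r (e : R) : 0 <= r -> 0 < e -> exists Q, forall x,
  x 'X <= r -> Num.max e (iter n f x P) = Num.max e (x Q).
Proof.
move=> + e0; elim: n P r => [|n IH] P r r0; first by exists P.
have [Q HQ] := IH P (mu f r) (mu_ge0 f r).
have G := sn_mult_seminorm (eta v r).
have M0 : 0 <= mu f r := mu_ge0 f r.
have [C [C0 HC]] := comp_poly_lipschitz G Q M0.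
have [|N HN] := term_small c_cvg r0 (_ : 0 < e / (C + 1)).
  by rewrite divr_gt0 // ltr_wpDl.
have tr_le m : eta v r (\poly_(i < m) c i) <= mu f r.
  apply: eta_le => // i; rewrite coef_poly; case: ifP => _.
    exact: mu_coef.
  by rewrite (ms_0 (absv_mult_seminorm v)) mul0r.
exists (Q \Po \poly_(i < N) c i) => x xr; rewrite iterSr.
rewrite HQ; last exact: f_le_mu.
(* all further truncations are as good as the [N]-th one *)
have H m : (N <= m)%N -> Num.max e (x (Q \Po \poly_(i < m) c i)) =
    Num.max e (x (Q \Po \poly_(i < N) c i)).
  move=> Nm; apply: ultra_max; apply: le_trans (ble_eta xr _) _.
  have [_ h] := HC _ _ (tr_le m) (tr_le N); apply: le_trans h _.
  apply: (@le_trans _ _ (C * (e / (C + 1)))); last first.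
    rewrite mulrA ler_pdivrMr ?ltr_wpDl // mulrC ler_wpM2l ?lerDl //.
    exact: ltW.
  rewrite ler_wpM2l //; apply: eta_le => //.
    by rewrite divr_ge0 ?addr_ge0 // ltW.
  move=> i; rewrite coefB !coef_poly; have [iN|Ni] := ltnP i N.
    rewrite (leq_trans iN Nm) subrr (ms_0 (absv_mult_seminorm v)) mul0r.
    by rewrite divr_ge0 ?addr_ge0 // ltW.
  rewrite subr0; case: ifP => _; first exact: HN.
  by rewrite (ms_0 (absv_mult_seminorm v)) mul0r divr_ge0 ?addr_ge0 // ltW.
have cv : (fun m => Num.max e (x (Q \Po \poly_(i < m) c i))) @ \oo -->
    Num.max e (f x Q).
  have h : Num.max e t @[t --> f x Q] --> Num.max e (f x Q).
    exact: max_cst_continuous.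
  exact: (cvg_comp _ _ (@f_series x Q) h).
apply: (real_cvg_unique _ cv).
have H' : \forall m \near \oo, Num.max e (x (Q \Po \poly_(i < N) c i)) =
    Num.max e (x (Q \Po \poly_(i < m) c i)).
  by exists N => // m /= Nm; rewrite H.
by apply: cvg_trans (near_eq_cvg H') _; exact: cvg_cst.
Qed.

Section Expanding.
Variables (R0 : R) (HR : expanding f c R0) (p : A1an v).
Hypotheses (fp : f p = p) (pR : p 'X <= R0).
Local Notation m_ := (mu f).

(** A point on the circle of radius [r] that follows the orbit of the Gauss point
    in absolute value for [n] steps, and then falls on the fixed point [p]. *)
Lemma exists_falling_orbit n r : R0 <= r -> critical f c (iter n m_ r) ->
  exists z, [/\ z 'X = r,
    forall l, (l <= n)%N -> iter l f z 'X = iter l m_ r &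
    iter n.+1 f z = p].
Proof.
elim: n r => [|n IH] r Rr Cr.
  have [|z [zr fz]] := preimage_critical c_cvg f_series c_inf HR Rr Cr (y := p).
    exact: le_lt_trans (le_trans pR Rr) (mu_gt HR Rr).
  by exists z; split=> // -[|l] //.
have Rm : R0 <= m_ r := le_trans Rr (ltW (mu_gt HR Rr)).
rewrite iterSr in Cr; have [w [wr wl wp]] := IH _ Rm Cr.
have [z [zr fz]] := preimage_circle c_cvg f_series c_inf HR Rr wr.
exists z; split=> //; last by rewrite iterSr fz.
by move=> [|l] // ln; rewrite !iterSr fz wl.
Qed.

(** A Gauss point which is a limit of points falling on [p] is a Julia point:
    it escapes to infinity. *)
Lemma julia_of_falling r (z : nat -> A1an v) : R0 <= r ->
  z @ \oo --> eta v r -> (forall j, exists n, iter n f (z j) = p) ->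
  Julia f (eta v r).
Proof.
move=> Rr zr zp [U [Uo Ur nor]].
have it n : iterates f (fun x => Some (iter n f x)) by exists n.
have [V [phi [g [Vr _ phi_homo gV gcont]]]] := nor _ it _ Ur.
have phi_ge n : (n <= phi n)%N.
  elim: n => // n IH; apply: leq_ltn_trans IH _; exact: phi_homo.
have Vy := nbhs_singleton Vr.
pose W M : set (P1an v) :=
  Some @` (~` [set x : A1an v | x 'X <= M]) `|` [set None].
have Wn M : nbhs (None : P1an v) (W M).
  by exists [set x : A1an v | x 'X <= M] => //; split;
    [exact: disc_compact|exact: disc_closed].
have gy : g (eta v r) = None.
  case E : (g (eta v r)) => [w|//]; have := gV _ Vy; rewrite E => gw.
  have Nw : nbhs (Some w : P1an v) (Some @` [set x : A1an v | x 'X < w 'X + 1]).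
    apply: one_point_compactification_some_nbhs.
    apply: (cvgr_lt _ (@sn_continuous _ _ v 'X w)); by rewrite ltrDl.
  have [N _ HN] := gw _ Nw.
  have /tends_to_inftyP /(_ (w 'X + 1)) [N' HN'] :=
    eta_tends_to_infty c_cvg f_series c_inf HR Rr.
  have [x /= xw [xE]] := HN (maxn N N') (leq_maxl _ _).
  have := HN' (phi (maxn N N')) (leq_trans (leq_maxr _ _) (phi_ge _)).
  by rewrite -xE => /(lt_trans xw); rewrite ltxx.
pose M := p 'X.
have Wnear : \forall x \near eta v r, V x -> W M (g x).
  have gW : nbhs (g (eta v r)) (W M) by rewrite gy.
  have := @gcont (eta v r) (W M) gW.
  by rewrite /= /nbhs /= -nbhs_subspace_in.
have [N _ HN] := zr _ (filterI Vr Wnear).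
have [Vz /(_ Vz) Wz] := HN N (leqnn N).
have Wopen (u : P1an v) : W M u -> nbhs u (W M).
  case: u => [x [[x' xM [<-]]|//]|_]; last exact: Wn.
  have : nbhs (Some x' : P1an v) (Some @` [set x : A1an v | M < x 'X]).
    apply: one_point_compactification_some_nbhs.
    apply: (cvgr_gt _ (@sn_continuous _ _ v 'X x')).
    by rewrite ltNge; apply/negP.
  apply: filterS => _ [t Mt <-]; left; exists t => //=.
  by apply/negP; rewrite -ltNge.
have [N' _ HN'] := gV _ Vz _ (Wopen _ Wz).
have [n zn] := zp N.
have pn m : (n <= m)%N -> iter m f (z N) = p.
  move=> /subnK <-; rewrite iterD zn; elim: (m - n)%N => // l IH.
  by rewrite iterS IH.
have := HN' (maxn N' n) (leq_maxl _ _).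
rewrite /= pn; last by apply: leq_trans (phi_ge _); exact: leq_maxr.
by case=> [[x xM [xp]]|//]; apply: xM; rewrite /= xp.
Qed.

(** If the orbit of [r] meets critical radii infinitely often, points falling
    on [p] occur in infinitely many directions at the Gauss point. *)
Lemma julia_of_recurrent_critical r : R0 <= r ->
  (forall N, exists n, (N <= n)%N /\ critical f c (iter n m_ r)) ->
  Julia f (eta v r).
Proof.
move=> Rr rec; have r0 : 0 < r := R0_gt0 HR Rr.
pose C n := critical f c (iter n m_ r).
have [e He] := choice rec.
have exz n : exists z : A1an v, C n -> [/\ z 'X = r,
    forall l, (l <= n)%N -> iter l f z 'X = iter l m_ r &
    iter n.+1 f z = p].
  have [Cn|nC] := pselect (C n); last by exists (eta v r).
  by have [z Hz] := exists_falling_orbit Rr Cn; exists z.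
have [z Hz] := choice exz.
apply: (@julia_of_falling r (fun n => z (e n))) => //; last first.
  by move=> j; exists (e j).+1; have [_ Ce] := He j; have [] := Hz _ Ce.
apply: (@cvg_separated _ _ _ _ _ C).
- by move=> P; exact: eta_gt0.
- by move=> n /Hz[zr _ _]; apply: ble_eta; rewrite zr.
- move=> i j Ci Cj ij; have [zi _ fi] := Hz i Ci; have [zj fj _] := Hz j Cj.
  pose m := iter i.+1 m_ r.
  have pm : p 'X < m.
    apply: le_lt_trans pR _; rewrite /m iterS.
    have Ri : R0 <= iter i m_ r := iter_mu_R0 HR i Rr.
    exact: le_lt_trans Ri (mu_gt HR Ri).
  have m0 : 0 < m := le_lt_trans (sn_ge0 p 'X) pm.
  have e0 : 0 < m / 2 by rewrite divr_gt0.
  have em : m / 2 < m by lra.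
  have [Q HQ] := iter_approx i.+1 'X (ltW r0) e0.
  have maxE t : Num.max (m / 2) m = Num.max (m / 2) t -> t = m.
    rewrite (max_r (ltW em)) => E; move: (em); rewrite {2}E lt_max ltxx /=.
    by move=> /ltW/max_r; rewrite -E.
  have yQ : eta v r Q = m.
    apply: maxE; rewrite -HQ; last by rewrite etaX // ltW.
    rewrite (iter_f_eta c_cvg f_series c_inf HR _ Rr) etaX // ltW //.
  exists Q; rewrite yQ; split.
    have := HQ (z i); rewrite zi lexx fi => /(_ isT) E.
    have : Num.max (m / 2) (z i Q) < m by rewrite -E gt_max em pm.
    by rewrite gt_max => /andP[].
  by apply: maxE; rewrite -HQ ?zj // fj.
- by move=> n; have [] := He n.
- by move=> n; have [] := He n.
Qed.

Lemma exists_julia_eta r : R0 <= r -> exists s, r <= s /\ Julia f (eta v s).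
Proof.
move=> Rr.
have [[s [rs rec]]|nrec] := pselect (exists s, r <= s /\
    forall N, exists n, (N <= n)%N /\ critical f c (iter n m_ s)).
  exists s; split=> //; apply: julia_of_recurrent_critical => //.
  exact: le_trans rs.
(* otherwise the critical radii pulled back to [[r, mu r]] accumulate *)
have H N : exists ns : nat * R, [/\ (N <= ns.1)%N, r <= ns.2, ns.2 <= m_ r &
    critical f c (iter ns.1 m_ ns.2)].
  have [n [s ?]] := critical_orbits c_cvg f_series c_inf HR N Rr.
  by exists (n, s).
have [u Hu] := choice H.
have [l [lI lcl]] : `[r, m_ r]%classic `&` cluster ((snd \o u) @ \oo) !=set0.
  apply: segment_compact; exists 0%N => // n _ /=.
  by have [_ r1 r2 _] := Hu n; rewrite in_itv /= r1 r2.
have rl : r <= l by move: lI; rewrite /= in_itv /= => /andP[].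
have [N0 HN0] : exists N0, forall n, (N0 <= n)%N ->
    ~ critical f c (iter n m_ l).
  apply: contrapT => /forallNP nN; apply: nrec; exists l; split=> // N.
  apply: contrapT => /forallNP nC; apply: (nN N) => n Nn Cn.
  exact: (nC n (conj Nn Cn)).
have seq j : exists nt : nat * R, [/\ r <= nt.2, nt.2 <> l,
    `|l - nt.2| < j.+1%:R^-1 & critical f c (iter nt.1 m_ nt.2)].
  have [] := lcl ((snd \o u) @` [set n | (N0 <= n)%N])
    (ball l (j.+1%:R^-1 : R)).
  - by exists N0 => // n N0n; exists n.
  - by apply: nbhsx_ballx; rewrite invr_gt0.
  move=> _ [[n N0n <-]] /= lb; have [nn rn _ Cn] := Hu n.
  exists (u n); split=> // E; rewrite E in Cn.
  exact: (HN0 _ (leq_trans N0n nn)).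
have [w Hw] := choice seq.
have exz j : exists z, z 'X = (w j).2 /\ iter (w j).1.+1 f z = p.
  have [rw _ _ Cw] := Hw j.
  have [z [zr _ zp]] := exists_falling_orbit (le_trans Rr rw) Cw.
  by exists z.
have [z Hz] := choice exz.
exists l; split=> //; have Rl := le_trans Rr rl.
apply: (@julia_of_falling l z) => //; last first.
  by move=> j; exists (w j).1.+1; case: (Hz j).
apply: cvg_eta_punctured; first exact: (R0_gt0 HR Rl).
  apply/cvgrPdist_lt => e e0.
  have [N _ HN] := near_infty_natSinv_lt (PosNum e0).
  exists N => // n Nn; have [-> _] := Hz n; have [_ _ d _] := Hw n.
  exact: lt_trans d (HN n Nn).
by move=> n; have [-> _] := Hz n; have [] := Hw n.
Qed.

End Expanding.

End Dynamics.
(** * The line cut at a Gauss point, and the basin of infinity *)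

Section Geometry.
Context (R : realType) (k : fieldType) (v : nonarch_absval R k).
Implicit Types (x y z : A1an v) (P Q : {poly k}) (r s t : R).

(** Gauss points are not rigid: a point of [K] is close to a root in [K] of
    some polynomial over [k], where this polynomial is too small. *)
Lemma eta_not_rigid r : 0 < r -> ~ rigid (eta v r).
Proof.
move=> r0 [K [w [a [[_ [L [i [j [_ alg aE wE dense]]]]] [b Hb]]]]].
have W := absv_mult_seminorm w; have r_ge0 := ltW r0.
have G := gauss_mult_seminorm W r_ge0.
have wb : w b = r.
  by have := Hb 'X; rewrite etaX // map_polyX hornerX.
have [y yb] := dense b r r0; have [P P0 Py] := alg y.
have aP : map_poly a P = map_poly j (map_poly i P).
  by rewrite -map_poly_comp; apply: eq_map_poly => e; exact: aE.
have /factor_theorem[Q HQ] : root (map_poly a P) (j y).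
  by rewrite aP fmorph_root.
have gE : gauss w r (map_poly a P) = eta v r P.
  rewrite etaE //; apply/eqP; rewrite eq_le; apply/andP; split.
    apply: (gauss_le (gauss_ge0 (absv_mult_seminorm v) r_ge0 P)) => l.
    by rewrite coef_map wE gauss_coef //; exact: absv_mult_seminorm.
  apply: (gauss_le (gauss_ge0 W r_ge0 _)) => l.
  by apply: le_trans (gauss_coef W r_ge0 _ l); rewrite coef_map wE.
have ev (S : {poly K}) : w S.[b] <= gauss w r S.
  rewrite horner_coef; apply: (ms_sum W); first exact: ms_ge0 G _.
  by move=> l _; rewrite (ms_M W) (ms_X W) wb gauss_coef.
have PG := eta_gt0 v r0 P0.
have g0 : 0 < gauss w r Q.
  move: PG; rewrite -gE HQ (ms_M G); have := ms_ge0 G Q.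
  by rewrite le_eqVlt => /orP[/eqP <-|//]; rewrite mul0r ltxx.
have : eta v r P < eta v r P.
  rewrite {1}Hb HQ hornerM (ms_M W) hornerXsubC -gE HQ (ms_M G).
  apply: (@lt_le_trans _ _ (gauss w r Q * r)).
    apply: (@le_lt_trans _ _ (gauss w r Q * w (b - j y))).
      by rewrite ler_wpM2r ?(ms_ge0 W).
    by rewrite ltr_pM2l.
  rewrite ler_pM2l //; apply: le_trans (gauss_coef W r_ge0 _ 1).
  by rewrite coefB coefX coefC subr0 (ms_1 W) mul1r expr1.
by rewrite ltxx.
Qed.

(** A Gauss point separates its disc from the rest of the line. *)
Lemma eta_separates r : 0 < r ->
  open [set x : A1an v | x 'X <= r /\ x <> eta v r].
Proof.
move=> r0; rewrite openE => z [zr zy].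
have [P zP] : exists P, z P < eta v r P.
  apply: contrapT => /forallNP nP; apply: zy; apply: ble_anti => [|P].
    exact: ble_eta.
  by rewrite leNgt; apply/negP; exact: nP.
have nP : \forall x \near z, sn x P < eta v r P.
  exact: cvgr_lt (@sn_continuous _ _ v P z) _ zP.
have nX : \forall x \near z, sn x 'X <= r \/ sn x P = eta v (sn x 'X) P.
  move: zr; rewrite le_eqVlt => /orP[/eqP zr|zr]; last first.
    have : \forall x \near z, sn x 'X < r.
      exact: cvgr_lt (@sn_continuous _ _ v 'X z) _ zr.
    by apply: filterS => x /ltW; left.
  have H : \forall t \near z 'X,
      forall x, x 'X = t -> t <> r -> x P = eta v t P.
    by rewrite zr; exact: eta_sn_punctured.
  have H' := @sn_continuous _ _ v 'X z _ H.
  apply: (@filterS _ (nbhs z) _ _ _ _ H') => x /= Hx.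
  have [xr|xr] := eqVneq (x 'X) r; first by left; rewrite xr.
  by right; apply: Hx => //; apply/eqP.
apply: filterS2 nP nX => x xP [xr|xE]; split.
- by [].
- by move=> E; move: xP; rewrite E ltxx.
- rewrite leNgt; apply/negP => rx; move: xP; rewrite xE ltNge => /negP; apply.
  by apply: ble_eta; rewrite etaX // ltW.
- by move=> E; move: xP; rewrite E ltxx.
Qed.

Lemma connected_below_eta (C : set (A1an v)) x r : 0 < r -> connected C ->
  C x -> ~ C (eta v r) -> x 'X <= r -> forall z, C z -> z 'X <= r.
Proof.
move=> r0 Cc Cx Cy xr; pose D := [set z : A1an v | z 'X <= r].
suff E : C `&` D = C by move=> z; rewrite -E => -[].
apply: Cc; first by exists x.
- exists [set z : A1an v | z 'X <= r /\ z <> eta v r].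
    exact: eta_separates.
  apply/seteqP; split=> z [Cz]; last by case.
  by move=> zr; split=> //; split=> // zE; apply: Cy; rewrite -zE.
- by exists D => //; exact: disc_closed.
Qed.

(** The segment from [x] to infinity is connected. *)
Lemma thicken_connected x : connected (thicken x @` `[0, +oo[).
Proof.
apply: connected_continuous_connected.
  exact/connected_intervalP/interval_is_interval.
by apply: continuous_subspaceT; exact: thicken_continuous.
Qed.

End Geometry.

Lemma basin_infty_connected (R : realType) (k : fieldType)
    (v : nonarch_absval R k) (f : A1an v -> A1an v) :
  (forall x y : A1an v, ble x y -> ble (f x) (f y)) ->
  connected (basin_infty f).
Proof.
(* the basin is closed upwards, since the iterates are monotone *)
move=> mono; have itm n x y : ble x y -> ble (iter n f x) (iter n f y).
  by move=> xy; elim: n => [//|n IH] /=; exact: mono.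
have up x y : basin_infty f x -> ble x y -> basin_infty f y.
  move=> /tends_to_inftyP xoo xy; apply/tends_to_inftyP => M.
  have [N HN] := xoo M; exists N => n /HN/lt_le_trans; apply.
  exact: itm.
have [[x0 Bx0]|B0] := pselect (basin_infty f !=set0); last first.
  have -> : basin_infty f = set0.
    by apply/seteqP; split=> // x Bx; apply: B0; exists x.
  exact: connected0.
have D0 x : (thicken x @` `[0, +oo[) x.
  by exists 0; rewrite ?thicken0 //= in_itv /= lexx.
have -> : basin_infty f =
    \bigcup_(x in basin_infty f)
      (thicken x @` `[0, +oo[ `|` thicken x0 @` `[0, +oo[).
  apply/seteqP; split=> [x Bx|x [y By [|]] [t _ <-]].
  - by exists x => //; left.
  - by apply: up By _; exact: thicken_ge.
  - by apply: up Bx0 _; exact: thicken_ge.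
apply: bigcup_connected; first by exists x0 => x _; right.
move=> x Bx; apply: connectedU; try exact: thicken_connected.
(* both segments end with the same Gauss points *)
pose t := Num.max (x 'X) (x0 'X).
have t0 : 0 <= t by rewrite le_max sn_ge0.
exists (eta v t); split; exists t; rewrite ?thicken_eta ?le_max ?lexx ?orbT //;
  by rewrite /= in_itv /= t0.
Qed.

Theorem theorem6p5 (R : realType) (k : fieldType) (v : nonarch_absval R k)
  (v_complete : absv_complete v) (v_nontrivial : absv_nontrivial v)
  (f : A1an v -> A1an v) (f_te : transcendental_entire f) :
  [/\ connected (basin_infty f),
      forall x : A1an v, exists y : A1an v,
        [/\ (above x `&` Julia f) y,
            forall n : nat, blt (iter n f y) (iter n.+1 f y) &
            tends_to_infty (fun n => iter n f y)],
      exists y : A1an v, Julia f y /\ ~ rigid y &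
      forall C : set (A1an v), Fatou_component f C -> bounded_an C].
Proof.
have [c [c_cvg f_series c_inf]] := f_te.
(* the radius [R0] of a fixed point [p] serves as the lower bound for radii *)
have [R1 H1] := exists_expanding f_series c_inf.
have [R0 [R10 CR0]] := critical_unbounded c_cvg f_series c_inf R1.
have [p [pR fp]] := exists_fixed_point c_cvg f_series c_inf H1 (ltW R10) CR0.
have HR : expanding f c R0.
  case: H1 => R1_1 H1; split; first exact: le_trans R1_1 (ltW R10).
  by move=> r Rr; apply: H1; apply: le_trans Rr; exact: ltW.
have pR' : p 'X <= R0 by rewrite pR.
have julia (x : A1an v) : exists s, [/\ R0 <= s, x 'X < s & Julia f (eta v s)].
  pose r := Num.max R0 (x 'X + 1).
  have Rr : R0 <= r by rewrite le_max lexx.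
  have [s [rs Js]] := exists_julia_eta c_cvg f_series c_inf HR fp pR' Rr.
  exists s; split=> //; first exact: le_trans rs.
  by apply: lt_le_trans rs; rewrite lt_max ltrDl ltr01 orbT.
split.
- apply: basin_infty_connected; exact: (f_monotone f_series).
- move=> x; have [s [Rs xs Js]] := julia x; exists (eta v s); split.
  + by split=> //; exact: blt_eta.
  + by move=> n; exact: (eta_orbit_increasing c_cvg f_series c_inf HR n Rs).
  + exact: (eta_tends_to_infty c_cvg f_series c_inf HR Rs).
- have [s [Rs _ Js]] := julia p; exists (eta v s); split=> //.
  by apply: eta_not_rigid; exact: (R0_gt0 HR Rs).
- move=> C [x Fx ->]; have [s [Rs xs Js]] := julia x; exists s.
  apply: (@connected_below_eta _ _ _ _ x).
  + exact: (R0_gt0 HR Rs).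
  + exact: component_connected.
  + exact: connected_component_refl.
  + by move=> /connected_component_sub.
  + exact: ltW.
Qed.
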